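(* Consider the Positivity task with $K$ arms and threshold $\theta$, in which one must decide whether there is an arm with mean lower than $\theta$. Then $$\inf_{\mathcal A\in\mathcal C_\infty}\ \sup_{\lambda\in\mathcal D}R_{H_{\mathcal C^{sp}},\infty}(\mathcal A,\lambda)=K.$$
   Context: Setting (fixed budget bandit identification). There are $K\ge 1$ arms. For each arm $k\in[K]=\{1,\dots,K\}$ a one-parameter canonical exponential family of real distributions is fixed; its members are identified with their means, which range over an open interval $\mathcal M_k$ (averages of samples lie in $\mathrm{cl}(\mathcal M_k)$). For $x,y\in\mathcal M_k$, $\mathrm{KL}(x,y)$ is the Kullback-Leibler divergence from the member with mean $x$ to the member with mean $y$. A bandit problem is identified with its mean vector. Positivity task: $\theta\in\bigcap_k\mathcal M_k$; the answer set is $\mathcal I=\{\text{all above},\text{exists below}\}$; $\mathcal D$ is the union of $\{\mu\in\prod_k\mathcal M_k:\mu_k>\theta\ \forall k\}$, on which $i^\star=\text{all above}$, and $\{\mu\in\prod_k\mathcal M_k:\exists k,\ \mu_k<\theta\}$, on which $i^\star=\text{exists below}$. $i^\star$ is extended with arbitrary values in $\mathcal I$ to $\prod_k\mathrm{cl}(\mathcal M_k)$. $\mathrm{Alt}(\mu)=\{\lambda\in\mathcal D:i^\star(\lambda)\ne i^\star(\mu)\}$. An algorithm with horizon $T$: at each time $t=1,\dots,T$ it chooses an arm $k_t$ based on the previous observations and observes an independent sample from the distribution of arm $k_t$; after time $T$ it returns an answer $\hat i_T\in\mathcal I$ based on the observations. $N_{T,k}$ is the number of samples of arm $k$ up to time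 $T$ and $\hat\mu_{T,k}$ is their average. The error probability on problem $\mu$ is $p_{\mu,T}(\mathcal A)=\mathbb P_{\mu,\mathcal A}(\hat i_T\ne i^\star(\mu))$. An algorithm family is a sequence $\mathcal A=(\mathcal A_T)_{T\ge1}$ of algorithms, one for each horizon $T$; $\mathcal C_\infty$ is the class of all algorithm families. Let $h_{\mu,T}(\mathcal A)=T/\log(1/p_{\mu,T}(\mathcal A))\in[0,\infty]$ ($=0$ if $p_{\mu,T}=0$, $=\infty$ if $p_{\mu,T}=1$). The oracle difficulty of a class $\mathcal C$ is $H_{\mathcal C}(\mu)=\inf_{\mathcal A\in\mathcal C}\limsup_{T\to\infty}h_{\mu,T}(\mathcal A)$. Static proportions: let $\triangle_K^0=\{\omega\in\triangle_K:\omega_k>0\ \forall k\}$, with $\triangle_K$ the probability simplex. A static proportions algorithm family parametrized by $\omega\in\triangle_K^0$ is one whose sampling rule satisfies $|N_{T,k}-T\omega_k|\le K$ for all $T$ and all $k\in[K]$, and which returns $\hat i_T=i^\star(\hat\mu_T)$. $\mathcal C^{sp}$ is the class of all of these, for all $\omega\in\triangle_K^0$; its oracle difficulty equals $H_{\mathcal C^{sp}}(\mu)=\big(\sup_{\omega\in\triangle_K^0}\inf_{\lambda\in\mathrm{Alt}(\mu)}\sum_{k}\omega_k\mathrm{KL}(\lambda_k,\mu_k)\big)^{-1}$. Difficulty ratio with respect to $H$: $R_{H,T}(\mathcal A,\mu)=h_{\mu,T}(\mathcal A)/H(\mu)$ and $R_{H,\infty}(\mathcal A,\mu)=\limsup_{T\to\infty}R_{H,T}(\mathcal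 A,\mu)$. *)

(* Defs.v *)
From HB Require Import structures.
From mathcomp Require Import all_boot all_order all_algebra.
From mathcomp Require Import all_classical all_reals all_analysis.

Set Implicit Arguments.
Unset Strict Implicit.
Unset Printing Implicit Defensive.

Import Order.TTheory GRing.Theory Num.Theory.
Import numFieldNormedType.Exports.

Local Open Scope classical_set_scope.
Local Open Scope ring_scope.

(* A one-parameter canonical exponential family on the real line, indexed by its
   means: the member with mean m has density x |-> exp (eta m * x - b m) with
   respect to the base measure, eta m being its natural parameter and b m its
   log-partition value. Nothing is required of eta, b and the distributions at
   points that are not means. Carrying the base measure by the closure of the
   interval of means is what keeps averages of samples in that closure. *)
Record exp_family (R : realType) := ExpFamily {
  ef_base : {sigma_finite_measure set (measurableTypeR R) -> \bar R};
  ef_means : set R;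
  ef_natparam : R -> R;
  ef_logpart : R -> R;
  ef_dist : R -> probability (measurableTypeR R) R;
  ef_means_open : open ef_means;
  ef_means_itv : is_interval ef_means;
  ef_base_closure : ef_base (~` closure ef_means) = 0%E;
  ef_distE : forall m, ef_means m -> forall U, measurable U ->
    ef_dist m U =
    (\int[ef_base]_(x in U) (expR (ef_natparam m * x - ef_logpart m))%:E)%E;
  ef_dist_integrable : forall m, ef_means m ->
    (ef_dist m).-integrable setT EFin;
  ef_dist_mean : forall m, ef_means m ->
    (\int[ef_dist m]_x x%:E)%E = m%:E
}.

Variant answer := AllAbove | ExistsBelow.

Section positivity.
Context {R : realType} {K : nat}.
Variables (F : 'I_K -> exp_family R) (theta : R).

Definition mean_vectors : set ('I_K -> R) :=
  [set mu | forall k, ef_means (F k) (mu k)].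

Definition all_above : set ('I_K -> R) :=
  [set mu | mean_vectors mu /\ forall k, theta < mu k].

Definition exists_below : set ('I_K -> R) :=
  [set mu | mean_vectors mu /\ exists k, mu k < theta].

Definition positivity_problems : set ('I_K -> R) := all_above `|` exists_below.

(* istar is the correct answer on the problems and is arbitrary elsewhere, up to
   measurability: otherwise the event that istar, evaluated at the empirical
   means, is wrong would have no probability. *)
Definition correct_answer (istar : ('I_K -> R) -> answer) : Prop :=
  [/\ forall mu, all_above mu -> istar mu = AllAbove,
      forall mu, exists_below mu -> istar mu = ExistsBelow &
      forall a, measurable [set v : K.-tuple (measurableTypeR R) |
                              istar (tnth v) = a]].

End positivity.

(* Histories list the observed samples in chronological order. The chosen arms
   need not be recorded since they are determined by the samples. *)
Record algorithm (R : realType) (K T : nat) := Algorithm {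
  alg_arm : seq R -> 'I_K;
  alg_answer : seq R -> answer;
  alg_arm_measurable : forall t, (t < T)%N -> forall k,
    measurable [set s : t.-tuple (measurableTypeR R) | alg_arm s = k];
  alg_answer_measurable : forall a,
    measurable [set s : T.-tuple (measurableTypeR R) | alg_answer s = a]
}.

(* The member at index 0 is immaterial: horizons are at least 1, and only limits
   superior along the horizon are taken. *)
Definition alg_family (R : realType) (K : nat) := forall T, algorithm R K T.

Definition all_families {R : realType} {K : nat} : set (alg_family R K) := setT.

Section interaction.
Context {R : realType} {K : nat}.

(* Probability that the history lies in B after n further rounds, starting from
   the history s. *)
Fixpoint interaction (nu : 'I_K -> probability (measurableTypeR R) R)
    (arm : seq R -> 'I_K) (B : set (seq R)) (n : nat) (s : seq R) : \bar R :=
  if n is n'.+1 then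
    (\int[nu (arm s)]_x interaction nu arm B n' (rcons s x))%E
  else (\1_B s)%:E.

Definition alg_prob T (nu : 'I_K -> probability (measurableTypeR R) R)
    (A : algorithm R K T) (B : set (seq R)) : \bar R :=
  interaction nu (alg_arm A) B T [::].

Definition num_samples T (A : algorithm R K T) (s : seq R) (k : 'I_K) : nat :=
  \sum_(t < T) (alg_arm A (take t s) == k).

(* 0 for an arm that has not been sampled. *)
Definition empirical_mean T (A : algorithm R K T) (s : seq R) (k : 'I_K) : R :=
  (\sum_(t < T | alg_arm A (take t s) == k) s`_t) / (num_samples A s k)%:R.

End interaction.

Section difficulty.
Context {R : realType} {K : nat}.
Variables (F : 'I_K -> exp_family R) (istar : ('I_K -> R) -> answer).

Definition error_prob T (A : algorithm R K T) (mu : 'I_K -> R) : \bar R :=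
  alg_prob (fun k => ef_dist (F k) (mu k)) A
    [set s | alg_answer A s <> istar mu].

(* The conventions of extended-real inverse and logarithm give 0 when the error
   probability is 0, and +oo when it is 1 and 0 < T. *)
Definition difficulty T (A : algorithm R K T) (mu : 'I_K -> R) : \bar R :=
  (T%:R%:E / lne (error_prob A mu)^-1)%E.

Definition oracle_difficulty (C : set (alg_family R K)) (mu : 'I_K -> R) :
    \bar R :=
  ereal_inf [set limn_esup (fun T => difficulty (A T) mu) | A in C].

Definition positive_simplex : set ('I_K -> R) :=
  [set w | (forall k, 0 < w k) /\ \sum_k w k = 1].

Definition static_proportions (w : 'I_K -> R) : set (alg_family R K) :=
  [set A | forall T, (0 < T)%N -> forall s : T.-tuple R,
     (forall k, `|(num_samples (A T) s k)%:R - T%:R * w k| <= K%:R) /\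
     alg_answer (A T) s = istar (empirical_mean (A T) s)].

Definition static_families : set (alg_family R K) :=
  \bigcup_(w in positive_simplex) static_proportions w.

Definition ratio (H : ('I_K -> R) -> \bar R) T (A : algorithm R K T)
    (mu : 'I_K -> R) : \bar R :=
  (difficulty A mu / H mu)%E.

Definition limit_ratio (H : ('I_K -> R) -> \bar R) (A : alg_family R K)
    (mu : 'I_K -> R) : \bar R :=
  limn_esup (fun T => ratio H (A T) mu).

End difficulty.

(* Main.v *)
(* Let H be the oracle difficulty of the static families. Both bounds come from
   the Chernoff bound (the empirical mean of N samples of an arm of mean m is
   beyond x with probability at most exp (- N KL(x, m))) and from a change of
   measure, which bounds below the error on a problem in terms of the information
   that an algorithm accurate on an alternative collects there.

   Upper bound. Uniform sampling with the answer given by the signs of the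
   empirical means minus theta gives each arm T / K samples, so the error decays
   at rate kappa / K, where kappa is the smallest KL(theta, mu_k) if all means are
   above theta and the largest one among the means below theta otherwise. The
   change of measure from an alternative whose relevant means are pushed just
   across theta shows that H(mu) is at least 1 / kappa.

   Lower bound. Take mu with all means slightly above theta, and for each j move
   the j-th mean slightly below theta to obtain lam_j. Some arm j receives at most
   T / K samples on average on mu, for infinitely many T, and the error on lam_j
   then decays at rate at most KL(mu_j, lam_jj) / K. A static family concentrated
   on arm j has rate almost KL(theta, lam_jj) on lam_j: arbitrary values of istar
   outside the means only create errors whose rate is bounded away from 0, while
   KL(theta, lam_jj) is as small as desired. *)

Require Import Defs.
From HB Require Import structures.
From mathcomp Require Import all_boot all_order all_algebra.
From mathcomp Require Import all_classical all_reals all_analysis.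
From mathcomp Require Import measurable_realfun zify ring lra.

Set Implicit Arguments.
Unset Strict Implicit.
Unset Printing Implicit Defensive.

Import Order.TTheory GRing.Theory Num.Theory.
Import numFieldNormedType.Exports.

Local Open Scope classical_set_scope.
Local Open Scope ring_scope.

(** * Exponential families *)

Section density.
Context {R : realType}.
Local Open Scope ereal_scope.
Import HBNNSimple.

(** Simple functions approximate [f] from below, and monotone convergence on both sides reduces the
    claim to indicators, where it is the hypothesis on [nu]. This turns the setwise densities of a
    family into a rule for integrating functions. *)
Lemma ge0_integral_density d (T : measurableType d)
    (mu nu : {measure set T -> \bar R}) (g : T -> \bar R) :
  measurable_fun setT g -> (forall x, 0 <= g x) -> (forall x, g x \is a fin_num) ->
  (forall U, measurable U -> nu U = \int[mu]_(x in U) g x) ->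
  forall f : T -> \bar R, measurable_fun setT f -> (forall x, 0 <= f x) ->
  \int[nu]_x f x = \int[mu]_x (f x * g x).
Proof.
move=> mg g0 gfin nuE f mf f0.
pose h := nnsfun_approx measurableT mf.
have mh n : measurable_fun setT (EFin \o h n).
  by apply/measurable_EFinP; exact/measurable_funP.
have -> : \int[nu]_x f x = lim (\int[nu]_x (EFin \o h n) x @[n --> \oo]).
  have fE x : f x = lim ((EFin \o h n) x @[n --> \oo]).
    by apply/esym/cvg_lim => //; exact: cvg_nnsfun_approx.
  under eq_integral => x _ do rewrite fE.
  apply: monotone_convergence => //.
  - by move=> n x _; rewrite lee_fin.
  - by move=> x _ a b ab; rewrite lee_fin; exact/lefP/nd_nnsfun_approx.
have -> : \int[mu]_x (f x * g x) =
    lim (\int[mu]_x ((EFin \o h n) \* g) x @[n --> \oo]).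
  have fg x : f x * g x = lim (((EFin \o h n) \* g) x @[n --> \oo]).
    apply/esym/cvg_lim => //; apply: cvgeZr; first exact: gfin.
    exact: cvg_nnsfun_approx.
  under eq_integral => x _ do rewrite fg.
  apply: monotone_convergence => //.
  - by move=> n; apply: emeasurable_funM.
  - by move=> n x _; rewrite /= mule_ge0 ?lee_fin.
  - by move=> x _ a b ab; rewrite /= lee_wpmul2r ?lee_fin//; exact/lefP/nd_nnsfun_approx.
suff suf n : \int[nu]_x (EFin \o h n) x = \int[mu]_x ((EFin \o h n) \* g) x.
  by under eq_fun do rewrite suf.
transitivity (\int[nu]_x
   (\sum_(y \in range (h n)) (y * \1_(h n @^-1` [set y]) x)%:E)).
  by apply: eq_integral => t tE; rewrite /= fimfunE -fsumEFin.
have indich r : measurable_fun setT (fun x => (r * \1_(h n @^-1` [set r]) x)%:E).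
  by apply/measurable_EFinP; exact: measurable_funM.
rewrite ge0_integral_fsum//; last by move=> y x _; exact: nnfun_muleindic_ge0.
transitivity (\int[mu]_x (\sum_(y \in range (h n))
    (y * \1_(h n @^-1` [set y]) x)%:E * g x)); last first.
  apply: eq_integral => x _.
  rewrite -ge0_mule_fsuml => [|y]; last exact: nnfun_muleindic_ge0.
  by rewrite fsumEFin // -(fimfunE _ x).
rewrite ge0_integral_fsum//; last 2 first.
  - by move=> y; apply: emeasurable_funM.
  - by move=> y x _; rewrite mule_ge0// nnfun_muleindic_ge0.
apply: eq_fsbigr => r rhn.
have mr : measurable (h n @^-1` [set r]) by [].
have mi : measurable_fun setT (fun x => (\1_(h n @^-1` [set r]) x)%:E : \bar R).
  by apply/measurable_EFinP.
have r0 : (0 <= r)%R by move: rhn; rewrite inE => -[x _ <-].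
under [LHS]eq_integral do rewrite EFinM.
rewrite ge0_integralZl ?lee_fin//.
rewrite integral_indic// setIT nuE//.
under [RHS]eq_integral do rewrite EFinM -muleA.
rewrite ge0_integralZl ?lee_fin//; last 2 first.
  - exact: emeasurable_funM.
  - by move=> x _; rewrite mule_ge0// lee_fin.
congr (_ * _); rewrite integral_mkcond; apply: eq_integral => x _.
by rewrite epatch_indic muleC.
Qed.

End density.

Lemma integral_prob_cst (R : realType) (P : probability (measurableTypeR R) R) (c : \bar R) :
  (\int[P]_t c = c)%E.
Proof. by rewrite integral_cst// [X in (_ * X)%E](probability_setT P) mule1. Qed.

Lemma Rintegral_prob_cst (R : realType) (P : probability (measurableTypeR R) R) (c : R) :
  \int[P]_t c = c.
Proof. by rewrite /Rintegral integral_prob_cst. Qed.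

Section exponential_family.
Context {R : realType} (E : exp_family R).
Local Notation M := (ef_means E).
Local Notation eta := (ef_natparam E).
Local Notation b := (ef_logpart E).
Local Notation P := (ef_dist E).

(* The logarithm of the density of the member with mean y with respect to the
   member with mean x. It is affine in t, hence its mean under the latter is its
   value at x. *)
Definition log_ratio (x y t : R) : R := (eta y - eta x) * t - b y + b x.

(** The Kullback-Leibler divergence in closed form: by [Rintegral_log_ratio], the value of
    [log_ratio x y] at [x] is its expectation under the member of mean [x]. *)
Definition kl (x y : R) : R := - log_ratio x y x.

Lemma measurable_log_ratio x y D : measurable_fun D (log_ratio x y).
Proof.
rewrite /log_ratio; apply: measurable_funD => //.
by apply: measurable_funB => //; apply: measurable_funM.
Qed.

Lemma change_of_measure x y (f : R -> \bar R) : M x -> M y ->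
  measurable_fun setT f -> (forall t, (0 <= f t)%E) ->
  (\int[P y]_t f t = \int[P x]_t (f t * (expR (log_ratio x y t))%:E))%E.
Proof.
move=> Mx My mf f0.
have me z : measurable_fun setT (fun t : R => (expR (eta z * t - b z))%:E).
  apply/measurable_EFinP; apply: measurableT_comp => //.
  by apply: measurable_funB => //; apply: measurable_funM.
have ge z t : (0 <= (expR (eta z * t - b z))%:E)%E by rewrite lee_fin expR_ge0.
have dE z : M z -> forall h : R -> \bar R, measurable_fun setT h ->
    (forall t, (0 <= h t)%E) ->
    (\int[P z]_t h t = \int[ef_base E]_t (h t * (expR (eta z * t - b z))%:E))%E.
  move=> Mz h mh h0; apply: ge0_integral_density => //; first exact: me.
  exact: ef_distE.
rewrite (dE y)// (dE x)//; last 2 first.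
- apply: emeasurable_funM => //; apply/measurable_EFinP.
  by apply: measurableT_comp => //; exact: measurable_log_ratio.
- by move=> t; rewrite mule_ge0// lee_fin expR_ge0.
apply: eq_integral => t _; rewrite -muleA -EFinM -expRD.
by congr (_ * (expR _)%:E)%E; rewrite /log_ratio; ring.
Qed.

Lemma integral_exp_log_ratio x y : M x -> M y ->
  (\int[P x]_t (expR (log_ratio x y t))%:E = 1)%E.
Proof.
move=> Mx My; have := @change_of_measure x y (cst 1%E) Mx My.
rewrite [LHS]integral_prob_cst => -> //.
by under [RHS]eq_integral do rewrite mul1e.
Qed.

Lemma integrable_log_ratio x y z : M z -> (P z).-integrable setT (EFin \o log_ratio x y).
Proof.
move=> Mz; rewrite (_ : _ \o _ = (fun t : R => (eta y - eta x)%:E * t%:E + (b x - b y)%:E)%E).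
  apply: integrableD => //.
    by apply: integrableZl => //; exact: ef_dist_integrable.
  exact: finite_measure_integrable_cst.
by apply/funext => t; rewrite /= /log_ratio -EFinM -EFinD; congr (_%:E); ring.
Qed.

Lemma Rintegral_log_ratio x y z : M z -> \int[P z]_t log_ratio x y t = log_ratio x y z.
Proof.
move=> Mz; rewrite /log_ratio.
have mean : \int[P z]_t t = z.
  by rewrite /Rintegral ef_dist_mean.
have int1 : (P z).-integrable setT (EFin \o (fun t : R => (eta y - eta x) * t)).
  rewrite (_ : _ \o _ = (fun t : R => (eta y - eta x)%:E * t%:E)%E)//.
  by apply: integrableZl => //; exact: ef_dist_integrable.
under eq_Rintegral do rewrite -addrA.
rewrite RintegralD//=; last exact: finite_measure_integrable_cst.
rewrite RintegralZl//; last exact: ef_dist_integrable.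
by rewrite mean Rintegral_prob_cst addrA.
Qed.

Lemma integrable_exp_log_ratio x y : M x -> M y ->
  (P x).-integrable setT (EFin \o (fun t => expR (log_ratio x y t))).
Proof.
move=> Mx My; apply/integrableP; split.
  apply/measurable_EFinP; apply: measurableT_comp => //; exact: measurable_log_ratio.
under eq_integral do rewrite gee0_abs ?lee_fin ?expR_ge0//.
by rewrite integral_exp_log_ratio// ltry.
Qed.

(** The inequality exp u >= 1 + u, integrated at u = [log_ratio x y], whose exponential has total
    mass 1. *)
Lemma kl_ge0 x y : M x -> M y -> 0 <= kl x y.
Proof.
move=> Mx My; rewrite /kl oppr_ge0 -(Rintegral_log_ratio x y Mx).
have -> : 0 = \int[P x]_t (expR (log_ratio x y t) - 1).
  rewrite RintegralB//; last 2 first.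
  - exact: integrable_exp_log_ratio.
  - exact: finite_measure_integrable_cst.
  by rewrite Rintegral_prob_cst /Rintegral integral_exp_log_ratio// subrr.
apply: le_Rintegral => //.
- exact: integrable_log_ratio.
- rewrite (_ : EFin \o _ = (fun t => (expR (log_ratio x y t))%:E - 1%:E)%E)//.
  apply: integrableB => //; first exact: integrable_exp_log_ratio.
  exact: finite_measure_integrable_cst.
- by move=> t _; have := expR_ge1Dx (log_ratio x y t); lra.
Qed.

(** Equal natural parameters make the densities proportional, normalization then equates the
    log-partition values, and equal distributions have equal means. *)
Lemma natparam_inj x y : M x -> M y -> eta x = eta y -> x = y.
Proof.
move=> Mx My exy.
have lE t : log_ratio x y t = b x - b y.
  by rewrite /log_ratio exy subrr mul0r add0r addrC.
have b0 : expR (b x - b y) = 1.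
  have := integral_exp_log_ratio Mx My.
  under eq_integral do rewrite lE.
  by rewrite integral_prob_cst => -[].
have bE : b x = b y by apply/eqP; rewrite -subr_eq0; apply/eqP/expR_inj; rewrite b0 expR0.
have PE U : measurable U -> P x U = P y U by move=> mU; rewrite !ef_distE// exy bE.
apply: EFin_inj; rewrite -(ef_dist_mean Mx) -(ef_dist_mean My).
by apply: eq_measure_integral => U mU _; exact: PE.
Qed.

(* The convex conjugate of the log-partition function, with subgradient eta; kl is
   its Bregman divergence. *)
Definition conj_logpart (x : R) : R := eta x * x - b x.

Lemma klE x y : kl x y = conj_logpart x - conj_logpart y - eta y * (x - y).
Proof. by rewrite /kl /log_ratio /conj_logpart; ring. Qed.

(** Nonnegativity of the Bregman divergence, read as convexity. The order properties of [kl] below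
    all rest on this inequality, and no derivative is ever taken. *)
Lemma conj_logpart_tangent x y : M x -> M y -> conj_logpart y + eta y * (x - y) <= conj_logpart x.
Proof. by move=> Mx My; have := kl_ge0 Mx My; rewrite klE; lra. Qed.

Lemma natparam_lt x y : M x -> M y -> x < y -> eta x < eta y.
Proof.
move=> Mx My xy; have nexy : eta x != eta y.
  by apply/eqP => /(natparam_inj Mx My) exy; rewrite exy ltxx in xy.
have := conj_logpart_tangent Mx My; have := conj_logpart_tangent My Mx.
rewrite lt_neqAle nexy/= => h1 h2.
suff : 0 <= (eta y - eta x) * (y - x) by rewrite pmulr_lge0 ?subr_gt0// subr_ge0.
by nra.
Qed.

Lemma natparam_le x y : M x -> M y -> x <= y -> eta x <= eta y.
Proof.
move=> Mx My; rewrite le_eqVlt => /predU1P[->//|xy].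
exact/ltW/natparam_lt.
Qed.

Lemma means_between x y z : M x -> M y -> x <= z <= y -> M z.
Proof. by move=> Mx My; exact: ef_means_itv. Qed.

Lemma kl_self x : kl x x = 0.
Proof. by rewrite klE !subrr mulr0 subrr. Qed.

(** Two tangent inequalities chained through the midpoint [z] bound [kl x y] below by half of (eta z
    - eta y) (x - y), which is positive by strict monotonicity. This avoids discussing equality in
    Jensen's inequality. *)
Lemma kl_gt0 x y : M x -> M y -> x != y -> 0 < kl x y.
Proof.
move=> Mx My xy; set z := (x + y) / 2%:R.
have Mz : M z.
  have [xley|/ltW ylex] := leP x y.
    by apply: (means_between Mx My); rewrite /z; lra.
  by apply: (means_between My Mx); rewrite /z; lra.
have h1 := conj_logpart_tangent Mx Mz; have h2 := conj_logpart_tangent Mz My.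
have xzE : x - z = (x - y) / 2%:R by rewrite /z; field.
have zyE : z - y = (x - y) / 2%:R by rewrite /z; field.
rewrite klE; rewrite xzE in h1; rewrite zyE in h2.
suff : 0 < (eta z - eta y) * (x - y) by lra.
have [xlty|yltx|xeqy] := ltgtP x y.
- rewrite nmulr_lgt0 ?subr_lt0//; apply: natparam_lt => //; rewrite /z; lra.
- rewrite pmulr_lgt0 ?subr_gt0//; apply: natparam_lt => //; rewrite /z; lra.
- by rewrite xeqy eqxx in xy.
Qed.

(** The right-hand side is the symmetrized divergence [kl x y + kl y x]. *)
Lemma kl_le_sym x y : M x -> M y -> kl x y <= (eta x - eta y) * (x - y).
Proof. by move=> Mx My; have := conj_logpart_tangent My Mx; rewrite klE; lra. Qed.

(** Three-point identity: kl x y - kl x y' = kl y' y + (eta y' - eta y) (x - y'), with both terms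
    nonnegative. [kl_rtl] is its mirror image. *)
Lemma kl_ltr x y y' : M x -> M y -> M y' -> y <= y' <= x -> kl x y' <= kl x y.
Proof.
move=> Mx My My' /andP[yy' y'x]; rewrite !klE.
have := conj_logpart_tangent My' My; have := natparam_le My My' yy'.
rewrite -subr_ge0 => h1 h2.
have : 0 <= (eta y' - eta y) * (x - y') by rewrite mulr_ge0// subr_ge0.
lra.
Qed.

Lemma kl_rtl x y y' : M x -> M y -> M y' -> x <= y' <= y -> kl x y' <= kl x y.
Proof.
move=> Mx My My' /andP[xy' y'y]; rewrite !klE.
have := conj_logpart_tangent My' My; have := natparam_le My' My y'y.
rewrite -subr_ge0 => h1 h2.
have : 0 <= (eta y - eta y') * (y' - x) by rewrite mulr_ge0// subr_ge0.
lra.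
Qed.

Lemma kl_sub x x' y : M x -> M x' -> kl x' y - kl x y <= (eta x' - eta y) * (x' - x).
Proof. by move=> Mx Mx'; have := conj_logpart_tangent Mx Mx'; rewrite !klE; lra. Qed.

(** Upper semicontinuity in the first argument. Monotonicity of the natural parameter bounds it on a
    neighbourhood, so its continuity is not called upon. *)
Lemma kl_lt_near x y e : M x -> M y -> 0 < e ->
  exists2 d, 0 < d & forall x', M x' -> `|x' - x| < d -> kl x' y < kl x y + e.
Proof.
move=> Mx My e0.
have [r r0 rM] : exists2 r, 0 < r & forall t, `|t - x| <= r -> M t.
  have /(_ x Mx)/nbhs_ballP[r/= r0 rM] := @ef_means_open _ E.
  exists (r / 2) => [|t tr]; first by rewrite divr_gt0.
  by apply: rM; rewrite /ball/= distrC (le_lt_trans tr)// ltr_pdivrMr//; lra.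
(* Bounds [eta x' - eta y] in absolute value for all [x'] within [r] of [x]; the summand 1 makes it
   positive. *)
set B := `|eta (x + r)| + `|eta (x - r)| + `|eta y| + 1.
have B0 : 0 < B by rewrite ltr_wpDl// !addr_ge0.
exists (Num.min r (e / B)) => [|x' Mx'].
  by rewrite lt_min r0 divr_gt0.
rewrite lt_min => /andP[x'r x'e].
have Mxr : M (x + r) by apply: rM; rewrite addrC addKr gtr0_norm.
have Mxr' : M (x - r) by apply: rM; rewrite addrC addKr normrN gtr0_norm.
move: (x'r); rewrite ltr_norml => /andP[h1 h2].
have e1 : eta x' <= eta (x + r) by apply: natparam_le => //; lra.
have e2 : eta (x - r) <= eta x' by apply: natparam_le => //; lra.
rewrite -ltrBlDl; apply: le_lt_trans (kl_sub y Mx Mx') _.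
apply: le_lt_trans (ler_norm _) _; rewrite normrM.
apply: (@le_lt_trans _ _ (B * `|x' - x|)); last by rewrite mulrC -ltr_pdivlMr.
rewrite ler_wpM2r// /B.
have := ler_norm (eta (x + r)); have := ler_norm (- eta (x - r)).
have := ler_norm (eta y); have := ler_norm (- eta y); rewrite !normrN.
have := normr_ge0 (eta (x + r)); have := normr_ge0 (eta (x - r)).
by rewrite ler_norml; lra.
Qed.

Lemma kl_small x e : M x -> 0 < e ->
  exists2 d, 0 < d & forall y, M y -> x - d < y < x -> kl x y < e.
Proof.
move=> Mx e0.
have [r r0 rM] : exists2 r, 0 < r & M (x - r).
  have /(_ x Mx)/nbhs_ballP[r/= r0 rM] := @ef_means_open _ E.
  exists (r / 2); first by rewrite divr_gt0.
  by apply: rM; rewrite /ball/= opprB addrC subrK gtr0_norm ?divr_gt0// ltr_pdivrMr//; lra.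
set B := eta x - eta (x - r).
have B0 : 0 < B by rewrite subr_gt0; apply: natparam_lt => //; lra.
exists (Num.min r (e / B)) => [|y My].
  by rewrite lt_min r0 divr_gt0.
move=> /andP[h1 h2].
have h3 : x - y < Num.min r (e / B) by lra.
move: h3; rewrite lt_min => /andP[h3 h4].
apply: le_lt_trans (kl_le_sym Mx My) _.
have e2 : eta (x - r) <= eta y by apply: natparam_le => //; lra.
apply: (@le_lt_trans _ _ (B * (x - y))); last by rewrite mulrC -ltr_pdivlMr.
by apply: ler_wpM2r; [lra|rewrite /B; lra].
Qed.

End exponential_family.

(** * Adaptive sampling *)

Section expectation.
Context {R : realType} {K : nat}.
Implicit Types (nu : 'I_K -> probability (measurableTypeR R) R).
Implicit Types (arm : seq R -> 'I_K) (g h : seq R -> R).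

Definition measurable_arm T arm := forall t, (t < T)%N -> forall k,
  measurable [set s : t.-tuple (measurableTypeR R) | arm s = k].

(** Histories are lists, so measurability is asked of the restriction to tuples of length [t].
    Boundedness gives integrability of the next step under every probability. *)
Definition bounded_measurable t g :=
  measurable_fun setT (fun s : t.-tuple (measurableTypeR R) => g s) /\
  exists C, forall s, size s = t -> `|g s| <= C.

(** Real-valued counterpart of [interaction] for general functionals: the conditional expectation
    given the history [s] with [n] rounds to go. One round is integrated at a time, so that no law
    on whole paths has to be built. *)
Fixpoint expectation nu arm g n (s : seq R) : R :=
  if n is n'.+1 then
    \int[nu (arm s)]_x expectation nu arm g n' (rcons s x)
  else g s.

Lemma measurable_rcons t :
  measurable_fun setT (fun z : t.-tuple (measurableTypeR R) * measurableTypeR R =>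
    [tuple of rcons z.1 z.2]).
Proof.
apply/measurable_fun_tnthP => i.
have [it|it] := ltnP i t.
  rewrite (_ : _ \o _ = (fun z => tnth z.1 (Ordinal it))).
    exact: (measurableT_comp (measurable_tnth _) measurable_fst).
  apply/funext => z /=.
  by rewrite (tnth_nth z.2) /= nth_rcons size_tuple it (tnth_nth z.2).
rewrite (_ : _ \o _ = snd); first exact: measurable_snd.
apply/funext => z /=; rewrite (tnth_nth z.2) /= nth_rcons size_tuple ltnNge it/=.
have /eqP : i = t :> nat by apply/eqP; rewrite eqn_leq it andbT -ltnS ltn_ord.
by move=> ->.
Qed.

Lemma measurable_rconsr t (s : t.-tuple (measurableTypeR R)) :
  measurable_fun setT (fun x : measurableTypeR R => [tuple of rcons s x]).
Proof. exact: (measurableT_comp (@measurable_rcons t) (pair1_measurable s)). Qed.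

Lemma bounded_measurableD t g h : bounded_measurable t g -> bounded_measurable t h ->
  bounded_measurable t (fun s => g s + h s).
Proof.
move=> [mg [C gC]] [mh [D hD]]; split; first exact: measurable_funD.
by exists (C + D) => s st; rewrite (le_trans (ler_normD _ _))// lerD ?gC ?hD.
Qed.

Lemma bounded_measurableM t g h : bounded_measurable t g -> bounded_measurable t h ->
  bounded_measurable t (fun s => g s * h s).
Proof.
move=> [mg [C gC]] [mh [D hD]]; split; first exact: measurable_funM.
by exists (C * D) => s st; rewrite normrM ler_pM ?gC ?hD.
Qed.

Lemma bounded_measurable_cst t c : bounded_measurable t (fun=> c).
Proof. by split => //; exists `|c|. Qed.

Lemma bounded_measurable_sum t (I : Type) (r : seq I) (g : I -> seq R -> R) :
  (forall i, bounded_measurable t (g i)) ->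
  bounded_measurable t (fun s => \sum_(i <- r) g i s).
Proof.
move=> mg; elim: r => [|i r ih].
  by under eq_fun do rewrite big_nil; exact: bounded_measurable_cst.
by under eq_fun do rewrite big_cons; exact: bounded_measurableD.
Qed.

Lemma bounded_measurable_indic t (B : set (seq R)) :
  measurable [set s : t.-tuple (measurableTypeR R) | B s] ->
  bounded_measurable t (\1_B).
Proof.
move=> mB; split; last first.
  by exists 1 => s _; rewrite indicE; case: (_ \in _); rewrite ?normr1 ?normr0.
have := @measurable_indic _ _ R setT _ mB.
by apply: eq_measurable_fun => s _; rewrite !indicE; congr (_%:R); rewrite !inE.
Qed.

Lemma integrable_rcons t h (P : probability (measurableTypeR R) R) s :
  bounded_measurable t.+1 h -> size s = t ->
  P.-integrable setT (EFin \o (fun x => h (rcons s x))).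
Proof.
move=> [mh [C hC]] st; apply: measurable_bounded_integrable => //.
- by rewrite (@le_lt_trans _ _ 1%E) ?probability_le1 ?ltry.
- subst t; exact: (measurableT_comp mh
    (measurable_rconsr (in_tuple s : (size s).-tuple (measurableTypeR R)))).
- exists C; split; first exact: num_real.
  by move=> D CD x _; apply: (le_trans _ (ltW CD)); apply: hC; rewrite size_rcons st.
Qed.

(** The chosen arm takes finitely many values on measurable pieces; on each piece the integrating
    measure is fixed and Tonelli's theorem applies. *)
Lemma bounded_measurable_step nu arm T t h :
  measurable_arm T arm -> (t < T)%N -> bounded_measurable t.+1 h ->
  bounded_measurable t (fun s => \int[nu (arm s)]_x h (rcons s x)).
Proof.
move=> marm tT bmh; have [mh [C hC]] := bmh; split; last first.
  exists C => s st; rewrite (le_trans (le_normr_Rintegral _ _))//.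
    exact: integrable_rcons bmh st.
  rewrite -[leRHS](Rintegral_prob_cst (nu (arm s))) le_Rintegral//.
  - have := integrable_rcons (nu (arm s)) bmh st; exact: integrable_norm.
  - exact: finite_measure_integrable_cst.
  - by move=> x _; rewrite hC// size_rcons st.
pose F k (s : seq R) : R := \int[nu k]_x h (rcons s x).
have mF k : measurable_fun setT (fun s : t.-tuple (measurableTypeR R) => F k s).
  (* Adding the bound [C] makes the integrand nonnegative, as Tonelli's theorem requires; it is
     subtracted again after integration. *)
  pose f (z : t.-tuple (measurableTypeR R) * measurableTypeR R) : \bar R :=
    (h (rcons z.1 z.2) + C)%:E.
  have C0 z : (0 <= f z)%E.
    rewrite lee_fin -lerBlDr sub0r.
    by have /hC : size (rcons z.1 z.2) = t.+1;
      rewrite ?size_rcons ?size_tuple// ler_norml => /andP[].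
  have mf : measurable_fun setT f.
    apply/measurable_EFinP; apply: measurable_funD => //.
    exact: (measurableT_comp mh (@measurable_rcons t)).
  have := measurable_fun_fubini_tonelli_F (m2 := nu k) f mf C0.
  move=> /(measurableT_comp (fine_measurable measurableT)) mG.
  have : measurable_fun setT (fun s => fine (fubini_F (nu k) f s) - C).
    exact: measurable_funB.
  apply: eq_measurable_fun => s _.
  rewrite /F /fubini_F /f -[fine _]/(\int[nu k]_x (h (rcons s x) + C)).
  rewrite RintegralD//; last 2 first.
  - by apply: integrable_rcons bmh _; rewrite size_tuple.
  - exact: finite_measure_integrable_cst.
  by rewrite Rintegral_prob_cst addrK.
have : measurable_fun setT (fun s : t.-tuple (measurableTypeR R) =>
    \sum_k \1_[set s : t.-tuple (measurableTypeR R) | arm s = k] s * F k s).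
  apply: measurable_sum => k; apply: measurable_funM => //.
  by apply: measurable_indic; exact: marm.
apply: eq_measurable_fun => s _.
rewrite (bigD1 (arm s))//= big1 ?addr0 => [|k karm].
  by rewrite indicE mem_set// mul1r.
by rewrite indicE memNset ?mul0r// => /= ks; rewrite ks eqxx in karm.
Qed.

Lemma bounded_measurable_expectation nu arm T g :
  measurable_arm T arm -> bounded_measurable T g ->
  forall n t, (t + n = T)%N -> bounded_measurable t (expectation nu arm g n).
Proof.
move=> marm bmg; elim=> [|n ih] t tn /=.
  by move: bmg; rewrite -tn addn0.
apply: bounded_measurable_step marm _ _; first by rewrite -tn -addSnnS leq_addr.
by apply: ih; rewrite addSnnS.
Qed.

Lemma interaction_expectation nu arm T B :
  measurable_arm T arm -> bounded_measurable T (\1_B) ->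
  forall n s, (size s + n = T)%N ->
  interaction nu arm B n s = (expectation nu arm (\1_B) n s)%:E.
Proof.
move=> marm bmB; elim=> [//|n ih] s sn /=.
under eq_integral do rewrite ih ?size_rcons ?addSnnS//.
rewrite fineK// integrable_fin_num//.
apply: integrable_rcons erefl.
by apply: (bounded_measurable_expectation _ marm bmB); rewrite addSnnS.
Qed.

Lemma expectation_lin nu arm T a g h :
  measurable_arm T arm -> bounded_measurable T g -> bounded_measurable T h ->
  forall n s, (size s + n = T)%N ->
  expectation nu arm (fun s => a * g s + h s) n s =
  a * expectation nu arm g n s + expectation nu arm h n s.
Proof.
move=> marm bmg bmh; elim=> [//|n ih] s sn /=.
under eq_Rintegral do rewrite ih ?size_rcons ?addSnnS//.
have bmE f : bounded_measurable T f ->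
    bounded_measurable (size s).+1 (expectation nu arm f n).
  by move=> bmf; apply: (bounded_measurable_expectation _ marm bmf); rewrite addSnnS.
have ig := integrable_rcons (nu (arm s)) (bmE _ bmg) erefl.
have ih' := integrable_rcons (nu (arm s)) (bmE _ bmh) erefl.
rewrite RintegralD// ?RintegralZl//.
rewrite (_ : _ \o _ = (fun x => a%:E * (expectation nu arm g n (rcons s x))%:E)%E)//.
exact: integrableZl.
Qed.

Lemma expectation_cst nu arm c n s : expectation nu arm (fun=> c) n s = c.
Proof.
elim: n s => [//|n ih] s /=.
by under eq_Rintegral do rewrite ih; rewrite Rintegral_prob_cst.
Qed.

Lemma expectation_le nu arm T g h :
  measurable_arm T arm -> bounded_measurable T g -> bounded_measurable T h ->
  (forall s, size s = T -> g s <= h s) ->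
  forall n s, (size s + n = T)%N ->
  expectation nu arm g n s <= expectation nu arm h n s.
Proof.
move=> marm bmg bmh gh; elim=> [|n ih] s sn /=.
  by apply: gh; rewrite -sn addn0.
have bmE f : bounded_measurable T f ->
    bounded_measurable (size s).+1 (expectation nu arm f n).
  by move=> bmf; apply: (bounded_measurable_expectation _ marm bmf); rewrite addSnnS.
have ig := integrable_rcons (nu (arm s)) (bmE _ bmg) erefl.
have ih' := integrable_rcons (nu (arm s)) (bmE _ bmh) erefl.
by apply: le_Rintegral => // x _; apply: ih; rewrite size_rcons addSnnS.
Qed.

Lemma expectation_sum nu arm T (I : Type) (r : seq I) (g : I -> seq R -> R) :
  measurable_arm T arm -> (forall i, bounded_measurable T (g i)) ->
  expectation nu arm (fun s => \sum_(i <- r) g i s) T [::] =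
  \sum_(i <- r) expectation nu arm (g i) T [::].
Proof.
move=> marm mg; elim: r => [|i r ih].
  rewrite big_nil -[RHS](expectation_cst nu arm 0 T [::]).
  by congr (expectation _ _ _ _ _); apply/funext => s; rewrite big_nil.
rewrite big_cons -ih -[X in X + _]mul1r.
have bms := bounded_measurable_sum r mg.
rewrite -(expectation_lin nu 1 marm (mg i) bms)//.
by congr (expectation _ _ _ _ _); apply/funext => s; rewrite big_cons mul1r.
Qed.

End expectation.

(** * Additive functionals of the history and a Chernoff bound for them *)

Section path_sums.
Context {R : realType} {K : nat}.
Implicit Types (nu : 'I_K -> probability (measurableTypeR R) R).
Implicit Types (arm : seq R -> 'I_K) (f : 'I_K -> R -> R).

(** With [f] a log-ratio this is a log-likelihood ratio; with [f] independent of the sample it is a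
    weighted count of the chosen arms. *)
Definition path_sum arm f (s : seq R) : R :=
  \sum_(0 <= t < size s) f (arm (take t s)) s`_t.

Lemma path_sum_nil arm f : path_sum arm f [::] = 0.
Proof. by rewrite /path_sum big_nil. Qed.

Lemma path_sum_rcons arm f s x :
  path_sum arm f (rcons s x) = path_sum arm f s + f (arm s) x.
Proof.
rewrite /path_sum size_rcons big_nat_recr//= nth_rcons ltnn eqxx.
have -> : take (size s) (rcons s x) = s by rewrite -cats1 take_size_cat.
congr (_ + _); apply: eq_big_nat => t /andP[_ ts].
by rewrite nth_rcons ts -cats1 take_cat ts.
Qed.

Lemma bounded_measurable_arm T arm (d : 'I_K -> R) t :
  measurable_arm T arm -> (t < T)%N ->
  bounded_measurable T (fun s => d (arm (take t s))).
Proof.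
move=> marm tT; split; last first.
  exists (\sum_k `|d k|) => s _.
  by rewrite (bigD1 (arm (take t s)))//= lerDl sumr_ge0.
pose r (s : T.-tuple (measurableTypeR R)) : t.-tuple (measurableTypeR R) :=
  [tuple tnth s (widen_ord (ltnW tT) i) | i < t].
have rE s : val (r s) = take t s.
  apply: (@eq_from_nth _ 0); first by rewrite size_tuple size_take size_tuple tT.
  move=> i; rewrite size_tuple => it.
  rewrite -(tnth_nth 0 (r s) (Ordinal it)) tnth_mktuple nth_take//.
  by rewrite (tnth_nth 0).
have rA s : arm (r s) = arm (take t s) by rewrite -rE.
have mr : measurable_fun setT r.
  apply/measurable_fun_tnthP => i.
  rewrite (_ : _ \o _ = fun s => tnth s (widen_ord (ltnW tT) i)).
    exact: measurable_tnth.
  by apply/funext => s /=; rewrite tnth_mktuple.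
have : measurable_fun setT (fun s : T.-tuple (measurableTypeR R) =>
    \sum_k d k * \1_[set u : t.-tuple (measurableTypeR R) | arm u = k] (r s)).
  apply: measurable_sum => k; apply: measurable_funM => //.
  by apply: (measurableT_comp _ mr); apply: measurable_indic; exact: marm.
apply: eq_measurable_fun => s _.
rewrite (bigD1 (arm (take t s)))//= big1 ?addr0 => [|k karm].
  by rewrite indicE mem_set ?mulr1//; exact: rA.
by rewrite indicE memNset ?mulr0// => /= ks; rewrite -ks (rA s) eqxx in karm.
Qed.

Lemma bounded_measurable_path_sum T arm (d : 'I_K -> R) :
  measurable_arm T arm -> bounded_measurable T (path_sum arm (fun k _ => d k)).
Proof.
move=> marm.
(* Zero beyond the horizon, because [bounded_measurable_sum] wants every summand bounded and
   measurable. *)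
pose g t (s : seq R) := if (t < T)%N then d (arm (take t s)) else 0.
have bg t : bounded_measurable T (g t).
  rewrite /g; have [tT|_] := ltnP t T; first exact: bounded_measurable_arm marm tT.
  exact: bounded_measurable_cst.
have [mg [C gC]] := bounded_measurable_sum (index_iota 0 T) bg.
have gE s : size s = T -> \sum_(0 <= t < T) g t s = path_sum arm (fun k _ => d k) s.
  by move=> sT; rewrite /path_sum sT; apply: eq_big_nat => t /andP[_ tT]; rewrite /g tT.
split; first by apply: eq_measurable_fun mg => s _; rewrite gE ?size_tuple.
by exists C => s sT; rewrite -gE// gC.
Qed.

(** Each exponential of a path sum is a supermartingale whatever arms are chosen, since each factor
    has mean at most 1. The sum of these exponentials dominates the indicator of [B] at the horizon,
    and induction carries the bound back to the start. *)
Lemma interaction_chernoff nu arm T B (I : finType) (f : I -> 'I_K -> R -> R) c :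
  measurable_arm T arm -> bounded_measurable T (\1_B) ->
  (forall i k, measurable_fun setT (f i k)) ->
  (forall i k, (\int[nu k]_x (expR (f i k x))%:E <= 1)%E) ->
  (forall s, size s = T -> B s -> exists i, c i <= path_sum arm (f i) s) ->
  forall n s, (size s + n = T)%N ->
  (interaction nu arm B n s <= \sum_i (expR (path_sum arm (f i) s - c i))%:E)%E.
Proof.
move=> marm bmB mf f1 cB; elim=> [|n ih] s sn.
  rewrite /= sumEFin lee_fin indicE; have [|_] := boolP (s \in B); last first.
    by apply: sumr_ge0 => i _; rewrite expR_ge0.
  (* On [B] some exponent is nonnegative, so a single term already reaches 1. *)
  rewrite inE => Bs; have [|i ci] := cB s _ Bs; first by rewrite -sn addn0.
  rewrite (bigD1 i)//= ler_wpDr ?sumr_ge0//.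
  by rewrite -expR0 ler_expR subr_ge0.
have me i : measurable_fun setT (fun x => (expR (f i (arm s) x))%:E : \bar R).
  by apply/measurable_EFinP; exact: measurableT_comp.
pose g i x := ((expR (path_sum arm (f i) s - c i))%:E * (expR (f i (arm s) x))%:E)%E.
have mg i : measurable_fun setT (g i) by exact: emeasurable_funM.
have g0 i x : (0 <= g i x)%E by rewrite mule_ge0// lee_fin expR_ge0.
rewrite /=; apply: (@le_trans _ _ (\int[nu (arm s)]_x (\sum_i g i x))%E).
  apply: ge0_le_integral => //.
  - move=> x _; rewrite (interaction_expectation _ marm bmB) ?size_rcons ?addSnnS//.
    rewrite lee_fin -(expectation_cst nu arm 0 n (rcons s x)).
    apply: (expectation_le _ marm _ bmB); rewrite ?size_rcons ?addSnnS//.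
    exact: bounded_measurable_cst.
  - have := bounded_measurable_expectation nu marm bmB (n := n) (t := (size s).+1).
    rewrite addSnnS => /(_ sn)/integrable_rcons/(_ erefl) => /(_ (nu (arm s)))/measurable_int.
    apply: eq_measurable_fun => x _ /=.
    by rewrite (interaction_expectation _ marm bmB) ?size_rcons ?addSnnS.
  - by apply: emeasurable_sum.
  - move=> x _; rewrite (le_trans (ih _ _)) ?size_rcons ?addSnnS//.
    apply: lee_sum => i _.
    by rewrite /g -EFinM -expRD lee_fin ler_expR path_sum_rcons; lra.
rewrite ge0_integral_sum//; apply: lee_sum => i _.
rewrite ge0_integralZl ?lee_fin ?expR_ge0//; last exact: me.
by rewrite -[leRHS]mule1; apply: lee_wpmul2l; [rewrite lee_fin expR_ge0|exact: f1].
Qed.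

End path_sums.

(** * Change of measure, for one round and then for the whole interaction *)

Section one_step.
Context {R : realType}.

(** The Donsker-Varadhan inequality for one sample: after a change of measure to [x], it is Jensen's
    inequality for the exponential of [h] plus the log-ratio. *)
Lemma exp_le_integral_exp (E : exp_family R) x y (h : R -> R) :
  ef_means E x -> ef_means E y -> measurable_fun setT h ->
  (ef_dist E x).-integrable setT (EFin \o h) ->
  (ef_dist E y).-integrable setT (EFin \o (fun t => expR (h t))) ->
  expR (\int[ef_dist E x]_t h t - kl E x y) <= \int[ef_dist E y]_t expR (h t).
Proof.
move=> Mx My mh ih ieh; set m := _ - _.
have meh : measurable_fun setT (fun t => (expR (h t))%:E : \bar R).
  by apply/measurable_EFinP; exact: measurableT_comp.
have cE : (\int[ef_dist E y]_t (expR (h t))%:E =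
           \int[ef_dist E x]_t (expR (h t + log_ratio E x y t))%:E)%E.
  rewrite (change_of_measure Mx My)//.
  by apply: eq_integral => t _; rewrite expRD EFinM.
have iel : (ef_dist E x).-integrable setT
    (EFin \o (fun t => expR (h t + log_ratio E x y t))).
  apply/integrableP; split.
    apply/measurable_EFinP; apply: measurableT_comp => //.
    by apply: measurable_funD => //; exact: measurable_log_ratio.
  under eq_integral do rewrite gee0_abs ?lee_fin ?expR_ge0//.
  rewrite -cE; case/integrableP : ieh => _.
  by under eq_integral do rewrite gee0_abs ?lee_fin ?expR_ge0//.
have il := integrable_log_ratio x y Mx.
have ihl : (ef_dist E x).-integrable setT
    (EFin \o (fun t => h t + log_ratio E x y t)).
  rewrite (_ : EFin \o _ = (fun t => (h t)%:E + (log_ratio E x y t)%:E)%E)//.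
  exact: integrableD.
have ic c : (ef_dist E x).-integrable setT (EFin \o (fun=> c)).
  exact: finite_measure_integrable_cst.
have ihlc : (ef_dist E x).-integrable setT
    (EFin \o (fun t => (h t + log_ratio E x y t) + (1 - m))).
  rewrite (_ : EFin \o _ = (fun t => (h t + log_ratio E x y t)%:E + (1 - m)%:E)%E)//.
  exact: (integrableD measurableT ihl (ic _)).
(* [m] is the mean of [h + log_ratio], so the tangent to exp at [m], evaluated there, integrates to
   [expR m]; exp lies above its tangent. *)
have -> : expR m = \int[ef_dist E x]_t (expR m * ((h t + log_ratio E x y t) + (1 - m))).
  rewrite RintegralZl// RintegralD// RintegralD// Rintegral_log_ratio// Rintegral_prob_cst.
  by rewrite /m /kl opprK; ring.
rewrite [leRHS]/Rintegral cE; apply: le_Rintegral => //.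
- rewrite (_ : EFin \o _ = (fun t => (expR m)%:E * ((h t + log_ratio E x y t) + (1 - m))%:E)%E)//.
  exact: integrableZl.
- move=> t _; set S := h t + _.
  have -> : expR S = expR m * expR (S - m) by rewrite -expRD addrC subrK.
  by rewrite ler_wpM2l ?expR_ge0//; have := expR_ge1Dx (S - m); lra.
Qed.

End one_step.

Section transportation.
Context {R : realType} {K : nat}.
Variables (F : 'I_K -> exp_family R) (lam mu : 'I_K -> R).
Hypotheses (Mlam : mean_vectors F lam) (Mmu : mean_vectors F mu).
Let nul k := ef_dist (F k) (lam k).
Let num k := ef_dist (F k) (mu k).
Let D arm := path_sum arm (fun k (_ : R) => kl (F k) (lam k) (mu k)).

Lemma bounded_measurable_expR t (g : seq R -> R) : bounded_measurable t g ->
  bounded_measurable t (fun s => expR (g s)).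
Proof.
move=> [mg [C gC]]; split; first exact: measurableT_comp.
exists (expR C) => s st; rewrite ger0_norm ?expR_ge0// ler_expR.
by rewrite (le_trans (ler_norm _))// gC.
Qed.

(** Donsker-Varadhan for the whole interaction, by induction on the remaining rounds. The factor 1 +
    (exp a - 1) P(B) is the mean of exp (a 1_B) under [mu], and each round costs the divergence of
    the arm chosen in it, which [D] records. *)
Lemma exp_expectation_le arm T B a :
  measurable_arm T arm -> bounded_measurable T (\1_B) ->
  forall n s, (size s + n = T)%N ->
  expR (expectation nul arm (fun s => a * \1_B s + - D arm s) n s) <=
  (1 + (expR a - 1) * expectation num arm (\1_B) n s) * expR (- D arm s).
Proof.
move=> marm bmB.
have bmD : bounded_measurable T (fun s => - D arm s).
  have := bounded_measurableM (bounded_measurable_cst T (-1))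
    (bounded_measurable_path_sum (fun k => kl (F k) (lam k) (mu k)) marm).
  by under eq_fun do rewrite mulN1r.
have bmG : bounded_measurable T (fun s => a * \1_B s + - D arm s).
  by apply: bounded_measurableD => //; apply: bounded_measurableM => //;
    exact: bounded_measurable_cst.
elim=> [|n ih] s sn.
  (* With no round left, exp (a 1_B) = 1 + (exp a - 1) 1_B exactly. *)
  rewrite /= expRD ler_wpM2r ?expR_ge0// indicE.
  by case: (s \in B); rewrite /= ?mulr1 ?mulr0 ?expR0; lra.
pose U x := expectation nul arm (fun s => a * \1_B s + - D arm s) n (rcons s x).
have bmU : bounded_measurable (size s).+1
    (expectation nul arm (fun s => a * \1_B s + - D arm s) n).
  by apply: (bounded_measurable_expectation _ marm bmG); rewrite addSnnS.
have bmP : bounded_measurable (size s).+1 (expectation num arm (\1_B) n).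
  by apply: (bounded_measurable_expectation _ marm bmB); rewrite addSnnS.
have iU := integrable_rcons (nul (arm s)) bmU erefl.
have ieU := integrable_rcons (num (arm s)) (bounded_measurable_expR bmU) erefl.
have mU : measurable_fun setT U.
  by have := measurable_int _ iU; move/measurable_EFinP.
have := exp_le_integral_exp (Mlam (arm s)) (Mmu (arm s)) mU iU ieU.
rewrite -/(nul _) -/(num _) expRD => h1.
set d := kl _ _ _ in h1; rewrite [expectation _ _ _ _ _]/= -/(U _).
have h2 : \int[num (arm s)]_t expR (U t) <=
    \int[num (arm s)]_t ((1 + (expR a - 1) * expectation num arm \1_B n (rcons s t)) *
      expR (- D arm s - d)).
  apply: le_Rintegral => //.
    apply: (@integrable_rcons _ (size s) (fun u => (1 + (expR a - 1) *
      expectation num arm \1_B n u) * expR (- D arm s - d))) => //.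
    apply: bounded_measurableM; last exact: bounded_measurable_cst.
    apply: bounded_measurableD; first exact: bounded_measurable_cst.
    by apply: bounded_measurableM bmP; exact: bounded_measurable_cst.
  move=> x _; rewrite (le_trans (ih _ _)) ?size_rcons ?addSnnS//.
  by rewrite /D path_sum_rcons opprD.
have iP := integrable_rcons (num (arm s)) bmP erefl.
have ic c : (num (arm s)).-integrable setT (EFin \o (fun=> c)).
  exact: finite_measure_integrable_cst.
have iaP : (num (arm s)).-integrable setT
    (EFin \o (fun t => (expR a - 1) * expectation num arm \1_B n (rcons s t))).
  rewrite (_ : EFin \o _ = (fun t =>
    (expR a - 1)%:E * (expectation num arm \1_B n (rcons s t))%:E)%E)//.
  exact: integrableZl.
rewrite RintegralZr// in h2; last first.
  rewrite (_ : EFin \o _ = (fun t =>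
    1%:E + ((expR a - 1) * expectation num arm \1_B n (rcons s t))%:E)%E)//.
  exact: (integrableD measurableT (ic 1) iaP).
rewrite RintegralD// RintegralZl// Rintegral_prob_cst expRD mulrA in h2.
rewrite -(ler_pM2r (expR_gt0 (- d))).
exact: (le_trans h1 h2).
Qed.

(** Linearizes the previous bound by exp u >= 1 + u, which leaves [a] free: it will be tuned so that
    the term with [expR a] is below 1. *)
Lemma transportation arm T B a :
  measurable_arm T arm -> bounded_measurable T (\1_B) ->
  a * expectation nul arm (\1_B) T [::] <=
  expR a * expectation num arm (\1_B) T [::] + expectation nul arm (D arm) T [::].
Proof.
move=> marm bmB.
have bmD := bounded_measurable_path_sum (fun k => kl (F k) (lam k) (mu k)) marm.
have := @exp_expectation_le arm T B a marm bmB T [::] erefl.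
rewrite /D path_sum_nil oppr0 expR0 mulr1.
have -> : expectation nul arm (fun s => a * \1_B s +
      - path_sum arm (fun k _ => kl (F k) (lam k) (mu k)) s) T [::] =
    a * expectation nul arm (\1_B) T [::] - expectation nul arm (D arm) T [::].
  transitivity (expectation nul arm (fun s => -1 * D arm s + a * \1_B s) T [::]).
    by congr (expectation _ _ _ _ _); apply/funext => s; rewrite mulN1r addrC.
  have bmaB : bounded_measurable T (fun s => a * \1_B s).
    by apply: bounded_measurableM => //; exact: bounded_measurable_cst.
  rewrite (expectation_lin _ _ marm)// mulN1r addrC; congr (_ + _).
  have := expectation_lin nul a marm bmB (bounded_measurable_cst T 0) (n := T) (s := [::]) erefl.
  rewrite expectation_cst addr0 => <-.
  by congr (expectation _ _ _ _ _); apply/funext => s; rewrite addr0.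
have P0 : 0 <= expectation num arm \1_B T [::].
  rewrite -[leLHS](expectation_cst num arm 0 T [::]).
  apply: (expectation_le _ marm _ bmB) => //; first exact: bounded_measurable_cst.
have := expR_ge1Dx (a * expectation nul arm (\1_B) T [::] - expectation nul arm (D arm) T [::]).
lra.
Qed.

End transportation.

(** * Error probabilities and difficulties *)

Section asymptotics.
Context {R : realType}.
Implicit Types u : (\bar R)^nat.

Lemma limn_esup_le u l N : (forall n, (N <= n)%N -> (u n <= l)%E) -> (limn_esup u <= l)%E.
Proof.
move=> ul; rewrite /limn_esup /limf_esup.
apply: (@le_trans _ _ (ereal_sup [set u x | x in [set n | (N <= n)%N]])).
  by apply: ereal_inf_lbound; exists [set n | (N <= n)%N] => //; exists N.
by apply: ge_ereal_sup => _ [n /= Nn <-]; exact: ul.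
Qed.

Lemma limn_esup_ge u l :
  (forall N, exists2 n, (N <= n)%N & (l <= u n)%E) -> (l <= limn_esup u)%E.
Proof.
move=> lu; apply: le_ereal_inf_tmp => _ [V [N _ NV] <-].
have [n Nn ln] := lu N; apply: (le_trans ln).
by apply: ereal_sup_ubound; exists n => //; exact: NV.
Qed.

Lemma nat_above (x : R) : exists N, forall n, (N <= n)%N -> x <= n%:R.
Proof.
exists (Num.truncn `|x|).+1 => n Nn.
rewrite (le_trans (ler_norm _))// ltW// (lt_le_trans (truncnS_gt _))// ler_nat//.
Qed.

Lemma ltn_add3 a b c n : (a + b + c < n)%N -> [/\ a <= n, b <= n, c <= n & 0 < n]%N.
Proof. by move=> h; split; lia. Qed.

(** An arbitrarily small loss of rate absorbs any constant factor, because exp (n (c - c'))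
    eventually exceeds [C]. *)
Lemma exp_rate_dominates (C c c' : R) : c' < c ->
  exists N, forall n, (N <= n)%N -> C * expR (- (n%:R * c)) <= expR (- (n%:R * c')).
Proof.
move=> cc'; have [N NC] := nat_above (C / (c - c')); exists N => n Nn.
have -> : expR (- (n%:R * c')) = expR (n%:R * (c - c')) * expR (- (n%:R * c)).
  by rewrite -expRD; congr expR; ring.
rewrite ler_wpM2r ?expR_ge0//.
have := NC _ Nn; rewrite ler_pdivrMr ?subr_gt0// => Cn.
by have := expR_ge1Dx (n%:R * (c - c')); lra.
Qed.

Lemma exp_rate_small (C c e : R) : 0 < c -> 0 < e ->
  exists N, forall n, (N <= n)%N -> C * expR (- (n%:R * c)) <= e.
Proof.
move=> c0 e0; have [N NC] := exp_rate_dominates (C / e) c0; exists N => n /NC.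
by rewrite mulr0 oppr0 expR0 mulrAC ler_pdivrMr// mul1r.
Qed.

Lemma log_difficulty_le T (p r : R) : (0 < T)%N -> 0 < r -> 0 <= p ->
  p <= expR (- (T%:R / r)) -> (T%:R%:E / lne p%:E^-1 <= r%:E)%E.
Proof.
move=> T0 r0; rewrite le_eqVlt => /predU1P[<- _|p0 pr].
  (* At [p] = 0 the logarithm is +oo and its inverse 0, so the quotient is 0. *)
  by rewrite inve0 /= mule0 lee_fin ltW.
rewrite inver gt_eqF// lne_EFin ?invr_gt0// lnV ?posrE//.
have lp : T%:R / r <= - ln p.
  by rewrite lerNr -[leRHS]expRK ler_ln// posrE ?expR_gt0.
have T0' : 0 < T%:R :> R by rewrite ltr0n.
have lp0 : 0 < - ln p by rewrite (lt_le_trans _ lp)// divr_gt0.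
rewrite inver gt_eqF// -EFinM lee_fin ler_pdivrMr//.
by rewrite mulrC -ler_pdivrMr.
Qed.

Lemma log_difficulty_ge T (p r : R) : (0 < T)%N -> 0 < r -> p <= 1 ->
  expR (- (T%:R / r)) <= p -> (r%:E <= T%:R%:E / lne p%:E^-1)%E.
Proof.
move=> T0 r0 p1 pr; have p0 : 0 < p by rewrite (lt_le_trans _ pr)// expR_gt0.
have T0' : 0 < T%:R :> R by rewrite ltr0n.
rewrite inver gt_eqF// lne_EFin ?invr_gt0// lnV ?posrE//.
have [p1'|p1'] := eqVneq p 1.
  (* At [p] = 1 the logarithm is 0 and its inverse +oo, so the quotient is +oo because [T] is
     positive. *)
  by rewrite p1' ln1 oppr0 inve0 gt0_muley ?leey// lte_fin.
have lp0 : 0 < - ln p by rewrite oppr_gt0 ln_lt0// p0 lt_neqAle p1' p1.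
have lp : - ln p <= T%:R / r.
  by rewrite lerNl -[leLHS]expRK ler_ln// posrE ?expR_gt0.
rewrite inver gt_eqF// -EFinM lee_fin ler_pdivlMr//.
by rewrite mulrC -ler_pdivlMr.
Qed.

End asymptotics.

Section algorithms.
Context {R : realType} {K : nat}.
Implicit Types (nu : 'I_K -> probability (measurableTypeR R) R).

Lemma bounded_measurable_answer T (A : algorithm R K T) a :
  bounded_measurable T (\1_[set s | alg_answer A s <> a] : seq R -> R).
Proof.
apply: bounded_measurable_indic.
rewrite (_ : [set _ | _] = ~` [set s : T.-tuple (measurableTypeR R) | alg_answer A s = a])//.
by apply: measurableC; exact: alg_answer_measurable.
Qed.

Variables (F : 'I_K -> exp_family R) (istar : ('I_K -> R) -> answer).

Definition error T (A : algorithm R K T) (mu : 'I_K -> R) : R :=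
  expectation (fun k => ef_dist (F k) (mu k)) (alg_arm A)
    (\1_[set s | alg_answer A s <> istar mu]) T [::].

Lemma error_probE T (A : algorithm R K T) mu :
  error_prob F istar A mu = (error A mu)%:E.
Proof.
rewrite /error_prob /alg_prob (interaction_expectation _ (T := T))//.
  exact: alg_arm_measurable.
exact: bounded_measurable_answer.
Qed.

Lemma expectation_indic_ge0_le1 nu T (A : algorithm R K T) B :
  bounded_measurable T (\1_B) -> 0 <= expectation nu (alg_arm A) \1_B T [::] <= 1.
Proof.
move=> bmB; have marm : measurable_arm T (alg_arm A) by exact: alg_arm_measurable.
apply/andP; split.
  rewrite -[leLHS](expectation_cst nu (alg_arm A) 0 T [::]).
  by apply: (expectation_le _ marm _ bmB) => //; exact: bounded_measurable_cst.
rewrite -[leRHS](expectation_cst nu (alg_arm A) 1 T [::]).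
by apply: (expectation_le _ marm bmB) => //; exact: bounded_measurable_cst.
Qed.

Lemma error_ge0 T (A : algorithm R K T) mu : 0 <= error A mu.
Proof.
by have /andP[] := expectation_indic_ge0_le1 (fun k => ef_dist (F k) (mu k)) A
  (bounded_measurable_answer A (istar mu)).
Qed.

Lemma error_le1 T (A : algorithm R K T) mu : error A mu <= 1.
Proof.
by have /andP[] := expectation_indic_ge0_le1 (fun k => ef_dist (F k) (mu k)) A
  (bounded_measurable_answer A (istar mu)).
Qed.

Lemma difficulty_le T (A : algorithm R K T) mu r : (0 < T)%N -> 0 < r ->
  error A mu <= expR (- (T%:R / r)) -> (difficulty F istar A mu <= r%:E)%E.
Proof.
move=> T0 r0 Ar; rewrite /difficulty error_probE.
by apply: log_difficulty_le; rewrite ?error_ge0.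
Qed.

Lemma difficulty_ge T (A : algorithm R K T) mu r : (0 < T)%N -> 0 < r ->
  expR (- (T%:R / r)) <= error A mu -> (r%:E <= difficulty F istar A mu)%E.
Proof.
move=> T0 r0 Ar; rewrite /difficulty error_probE.
by apply: log_difficulty_ge; rewrite ?error_le1.
Qed.

Lemma difficulty_ge0 T (A : algorithm R K T) mu : (0 <= difficulty F istar A mu)%E.
Proof.
rewrite /difficulty error_probE mule_ge0 ?lee_fin ?ler0n// inve_ge0 lne_ge0.
have := error_ge0 A mu; rewrite le_eqVlt => /predU1P[<-|e0]; first by rewrite inve0 leey.
by rewrite inver gt_eqF// lee_fin invf_ge1// error_le1.
Qed.

Lemma difficulty_eventually_le (A : alg_family R K) mu (C c r : R) : 0 < r -> r^-1 < c ->
  (forall T, (0 < T)%N -> error (A T) mu <= C * expR (- (T%:R * c))) ->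
  exists N, forall T, (N <= T)%N -> (difficulty F istar (A T) mu <= r%:E)%E.
Proof.
move=> r0 rc errA; have [N NC] := exp_rate_dominates C rc.
exists N.+1 => T NT; have T0 : (0 < T)%N by exact: leq_trans NT.
by apply: difficulty_le => //; rewrite (le_trans (errA _ T0))// NC// ltnW.
Qed.

Lemma limsup_difficulty_le (A : alg_family R K) mu (C c : R) : 0 < c ->
  (forall T, (0 < T)%N -> error (A T) mu <= C * expR (- (T%:R * c))) ->
  (limn_esup (fun T => difficulty F istar (A T) mu) <= c^-1%:E)%E.
Proof.
move=> c0 errA; apply/lee_addgt0Pr => e e0; rewrite -EFinD.
have [||N NP] := difficulty_eventually_le (r := c^-1 + e) _ _ errA.
- by rewrite addr_gt0// invr_gt0.
- by rewrite invf_plt ?posrE ?ltrDl// addr_gt0// invr_gt0.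
exact: limn_esup_le NP.
Qed.

(** Transportation from [lam] to [mu] with a = T / r, for the event that the answer differs from
    [istar mu]. A too small error on [mu] thus forces the algorithm to collect much information on
    [lam]. *)
Lemma error_lt_transportation T (A : algorithm R K T) lam mu r :
  mean_vectors F lam -> mean_vectors F mu -> istar lam <> istar mu ->
  0 < r -> error A mu < expR (- (T%:R / r)) ->
  T%:R / r * (1 - error A lam) < 1 +
    expectation (fun k => ef_dist (F k) (lam k)) (alg_arm A)
      (path_sum (alg_arm A) (fun k _ => kl (F k) (lam k) (mu k))) T [::].
Proof.
move=> Mlam Mmu neq r0 Amu; have marm : measurable_arm T (alg_arm A) by exact: alg_arm_measurable.
have bmB := bounded_measurable_answer A (istar mu).
have bmL := bounded_measurable_answer A (istar lam).
have := transportation Mlam Mmu (T%:R / r) marm bmB.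
rewrite -/(error A mu) => h.
have h1 : expR (T%:R / r) * error A mu < 1.
  by rewrite mulrC -ltr_pdivlMr ?expR_gt0// mul1r -expRN.
have h2 : 1 - error A lam <= expectation (fun k => ef_dist (F k) (lam k)) (alg_arm A)
    \1_[set s | alg_answer A s <> istar mu] T [::].
  rewrite lerBlDr.
  set nu := fun k => _.
  have := expectation_lin nu 1 marm bmB bmL (n := T) (s := [::]) erefl.
  rewrite mul1r -/(error A lam) => <-.
  rewrite -[leLHS](expectation_cst nu (alg_arm A) 1 T [::]).
  apply: (expectation_le _ marm) => //.
  - exact: bounded_measurable_cst.
  - apply: bounded_measurableD => //; apply: bounded_measurableM => //.
    exact: bounded_measurable_cst.
  move=> s _; rewrite mul1r !indicE.
  have [|/negP] := boolP (s \in [set s | alg_answer A s <> istar mu]).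
    by rewrite lerDl ler0n.
  rewrite inE /= => /contrapT Amus.
  by rewrite add0r mem_set//= Amus; exact/nesym.
have h3 : T%:R / r * (1 - error A lam) <= T%:R / r *
    expectation (fun k => ef_dist (F k) (lam k)) (alg_arm A)
    \1_[set s | alg_answer A s <> istar mu] T [::].
  by rewrite ler_wpM2l// divr_ge0// ltW.
lra.
Qed.

End algorithms.

(** * Concentration of the empirical means *)

Lemma pos_lower_bound (R : realType) (I : finType) (g : I -> R) :
  (forall i, 0 < g i) -> exists2 c, 0 < c & forall i, c <= g i.
Proof.
move=> g0; exists (\big[Order.min/1]_i g i).
  by rewrite lt_bigmin.
by move=> i; exact: bigmin_le.
Qed.

Section concentration.
Context {R : realType} {K : nat}.
Variables (F : 'I_K -> exp_family R).

(** Holds for an unsampled arm too: its sum is empty and its count is 0. *)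
Lemma sum_samples T (A : algorithm R K T) (s : seq R) k :
  \sum_(t < T | alg_arm A (take t s) == k) s`_t =
  (num_samples A s k)%:R * empirical_mean A s k.
Proof.
rewrite /empirical_mean; have [N0|N0] := eqVneq (num_samples A s k) 0%N.
  rewrite N0 mul0r big1// => t tk.
  move/eqP: N0; rewrite /num_samples sum_nat_eq0 => /forallP/(_ t).
  by rewrite tk.
by rewrite mulrC divfK// pnatr_eq0.
Qed.

(** The log-ratio is affine in the sample, so the log-likelihood ratio of one arm depends only on
    its count and its empirical mean. *)
Lemma path_sum_log_ratio T (A : algorithm R K T) (s : seq R) k (x y : R) :
  size s = T ->
  path_sum (alg_arm A)
    (fun j t => if j == k then log_ratio (F k) y x t else 0) s =
  (num_samples A s k)%:R * log_ratio (F k) y x (empirical_mean A s k).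
Proof.
move=> sT; rewrite /path_sum sT big_mkord -big_mkcond/=.
rewrite [in RHS]/log_ratio -addrA mulrDr mulrCA -sum_samples mulr_sumr.
rewrite /num_samples natr_sum mulr_suml.
have -> : \sum_(t < T) (alg_arm A (take t s) == k)%:R *
    (- ef_logpart (F k) x + ef_logpart (F k) y) =
    \sum_(t < T | alg_arm A (take t s) == k)
    (- ef_logpart (F k) x + ef_logpart (F k) y).
  by rewrite [RHS]big_mkcond; apply: eq_bigr => t _; case: eqP; rewrite ?mul1r ?mul0r.
by rewrite -big_split/=; apply: eq_bigr => t _; rewrite /log_ratio addrA.
Qed.

(** Equality holds at [m] = [x], and the slope eta x - eta y has the sign that makes the log-ratio
    grow as [m] moves from [x] away from [y]. *)
Lemma kl_le_log_ratio E (x y m : R) : ef_means E x -> ef_means E y ->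
  (x < y /\ m <= x) \/ (y < x /\ x <= m) -> kl E x y <= log_ratio E y x m.
Proof.
move=> Mx My h; rewrite /kl /log_ratio.
suff : 0 <= (ef_natparam E x - ef_natparam E y) * (m - x) by lra.
case: h => -[xy mx].
  by rewrite mulr_le0// subr_le0//; apply: natparam_le => //; exact: ltW.
by rewrite mulr_ge0// subr_ge0//; apply: natparam_le => //; exact: ltW.
Qed.

(* The exponential supermartingale is the likelihood ratio of the level x i
   against the true mean. *)
Lemma deviation_bound T (A : algorithm R K T) mu B (I : finType)
    (k : I -> 'I_K) (x n : I -> R) :
  mean_vectors F mu -> (forall i, ef_means (F (k i)) (x i)) ->
  bounded_measurable T (\1_B : seq R -> R) ->
  (forall s, size s = T -> B s -> exists i, n i <= (num_samples A s (k i))%:R /\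
    ((x i < mu (k i) /\ empirical_mean A s (k i) <= x i) \/
     (mu (k i) < x i /\ x i <= empirical_mean A s (k i)))) ->
  expectation (fun j => ef_dist (F j) (mu j)) (alg_arm A) \1_B T [::] <=
  \sum_i expR (- (n i * kl (F (k i)) (x i) (mu (k i)))).
Proof.
move=> Mmu Mx bmB dev.
have marm : measurable_arm T (alg_arm A) by exact: alg_arm_measurable.
pose f i j t := if j == k i then log_ratio (F (k i)) (mu (k i)) (x i) t else 0.
rewrite -lee_fin -(interaction_expectation _ marm bmB)//.
have := @interaction_chernoff R K (fun j => ef_dist (F j) (mu j)) (alg_arm A) T B I f
  (fun i => n i * kl (F (k i)) (x i) (mu (k i))) marm bmB _ _ _ T [::] erefl.
have -> : (\sum_i (expR (path_sum (alg_arm A) (f i) [::] -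
      n i * kl (F (k i)) (x i) (mu (k i))))%:E)%E =
    (\sum_i expR (- (n i * kl (F (k i)) (x i) (mu (k i)))))%:E.
  rewrite sumEFin; congr (_%:E); apply: eq_bigr => i _.
  by rewrite path_sum_nil sub0r.
apply.
- by move=> i j; rewrite /f; case: (j == k i) => //; exact: measurable_log_ratio.
- move=> i j; rewrite /f; have [->|jk] := eqVneq j (k i).
    by rewrite integral_exp_log_ratio.
  by under eq_integral do rewrite expR0; rewrite integral_prob_cst.
move=> s sT /(dev _ sT)[i [nN h]]; exists i.
rewrite path_sum_log_ratio//.
apply: (@le_trans _ _ ((num_samples A s (k i))%:R * kl (F (k i)) (x i) (mu (k i)))).
  by rewrite ler_wpM2r// kl_ge0.
by rewrite ler_wpM2l//; apply: kl_le_log_ratio.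
Qed.

(** The slack [K] in the sample counts only costs a constant factor, so the rate is governed by the
    proportions [w]. *)
Lemma deviation_rate T (A : algorithm R K T) mu B (I : finType)
    (k : I -> 'I_K) (x w : I -> R) c :
  mean_vectors F mu -> (forall i, ef_means (F (k i)) (x i)) ->
  bounded_measurable T (\1_B : seq R -> R) ->
  (forall i, c <= w i * kl (F (k i)) (x i) (mu (k i))) ->
  (forall s, size s = T -> B s -> exists i,
    T%:R * w i - K%:R <= (num_samples A s (k i))%:R /\
    ((x i < mu (k i) /\ empirical_mean A s (k i) <= x i) \/
     (mu (k i) < x i /\ x i <= empirical_mean A s (k i)))) ->
  expectation (fun j => ef_dist (F j) (mu j)) (alg_arm A) \1_B T [::] <=
  (\sum_i expR (K%:R * kl (F (k i)) (x i) (mu (k i)))) * expR (- (T%:R * c)).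
Proof.
move=> Mmu Mx bmB cw dev; apply: (le_trans (deviation_bound Mmu Mx bmB dev)).
rewrite mulr_suml; apply: ler_sum => i _; rewrite -expRD ler_expR.
have : T%:R * c <= T%:R * (w i * kl (F (k i)) (x i) (mu (k i))) by rewrite ler_wpM2l.
lra.
Qed.

End concentration.

(** * Exponential accuracy of static families and the information bound it entails *)

Section static.
Context {R : realType} {K : nat}.
Variables (F : 'I_K -> exp_family R) (theta : R) (istar : ('I_K -> R) -> answer).
Hypotheses (htheta : forall k, ef_means (F k) theta)
  (histar : correct_answer F theta istar).

Lemma problem_mean mu : positivity_problems F theta mu -> mean_vectors F mu.
Proof. by case=> -[]. Qed.

(* istar is arbitrary outside the means, so that empirical means outside the box
   have to be counted as errors even when they are on the right side of theta. *)
Lemma static_error_box (A : alg_family R K) w mu (l u : 'I_K -> R) c :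
  static_proportions istar w A -> mean_vectors F mu ->
  mean_vectors F l -> mean_vectors F u -> (forall k, l k < mu k < u k) ->
  (forall v, (forall k, l k < v k < u k) -> istar v = istar mu) ->
  (forall k, c <= w k * kl (F k) (l k) (mu k)) ->
  (forall k, c <= w k * kl (F k) (u k) (mu k)) ->
  exists C, forall T, (0 < T)%N -> error F istar (A T) mu <= C * expR (- (T%:R * c)).
Proof.
move=> stA Mmu Ml Mu lmuu box cl cu.
(* One deviation event for each arm and each end of its interval, [true] standing for the upper end;
   an error needs one of them. *)
pose x (i : 'I_K * bool) := if i.2 then u i.1 else l i.1.
exists (\sum_(i : 'I_K * bool) expR (K%:R * kl (F i.1) (x i) (mu i.1))) => T T0.
apply: (@deviation_rate _ _ F _ (A T) mu _ _ fst x (fun i => w i.1)) => //.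
- by case=> k [].
- exact: bounded_measurable_answer.
- by case=> k [].
move=> s sT /= err.
have [Nw ansA] := stA T T0 (Tuple (introT eqP sT)).
have : ~ forall k, l k < empirical_mean (A T) s k < u k.
  by move=> /box ist; apply: err; rewrite -ist; exact: ansA.
move=> /existsNP[k] /negP; rewrite negb_and -!leNgt => h.
have Nk : T%:R * w k - K%:R <= (num_samples (A T) s k)%:R.
  by have := Nw k; rewrite ler_norml => /andP[+ _] => /=; lra.
have /andP[lmu muu] := lmuu k.
have [h1|h1] := orP h; first by exists (k, false); split => //; left.
by exists (k, true); split => //; right.
Qed.

(** Each interval has its ends among the means and does not cross [theta] unless its centre is
    [theta] itself. Every vector in the box is then a problem with the same answer as [mu]. *)
Lemma problem_box mu : positivity_problems F theta mu -> exists l u : 'I_K -> R,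
  [/\ mean_vectors F l, mean_vectors F u, forall k, l k < mu k < u k &
      forall v, (forall k, l k < v k < u k) -> istar v = istar mu].
Proof.
move=> pmu; have Mmu := problem_mean pmu.
have arm_box k : exists lu : R * R, [/\ ef_means (F k) lu.1, ef_means (F k) lu.2,
    lu.1 < mu k < lu.2, theta < mu k -> theta <= lu.1 & mu k < theta -> lu.2 <= theta].
  have /(_ _ (Mmu k))/nbhs_ballP[r/= r0 rM] := @ef_means_open _ (F k).
  have Mr t : `|mu k - t| < r -> ef_means (F k) t by exact: rM.
  have [hlt|hgt|muE] := ltgtP (mu k) theta.
  - exists (mu k - r / 2, theta); split => //=; try by lra.
    by apply: Mr; rewrite opprB addrC subrK gtr0_norm; lra.
  - exists (theta, mu k + r / 2); split => //=; try by lra.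
    by apply: Mr; rewrite opprD addrA subrr sub0r normrN gtr0_norm; lra.
  (* A mean equal to [theta] can occur beside a smaller one in [exists_below]; that arm may move to
     either side. *)
  - exists (theta - r / 2, theta + r / 2); split => //=; try by lra.
    + by apply: Mr; rewrite muE opprB addrC subrK gtr0_norm; lra.
    + by apply: Mr; rewrite muE opprD addrA subrr sub0r normrN gtr0_norm; lra.
have [lu luP] := boolp.choice arm_box.
exists (fst \o lu), (snd \o lu); split.
- by move=> k /=; case: (luP k).
- by move=> k /=; case: (luP k).
- by move=> k /=; case: (luP k).
move=> v vbox; have Mv : mean_vectors F v.
  move=> k; have [Ml Mu _ _ _] := luP k.
  by apply: (means_between Ml Mu); have /andP[/ltW-> /ltW->] := vbox k.
have [iA iB _] := histar.
case: pmu => -[_ h].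
  rewrite [RHS]iA ?iA//; split => // k; have [_ _ _ /(_ (h k)) tl _] := luP k.
  by have /andP[+ _] := vbox k; exact: le_lt_trans.
case: h => k muk; rewrite [RHS]iB ?iB//; split => //; exists k => //.
have [_ _ _ _ /(_ muk) ut] := luP k.
by have /andP[_ +] := vbox k => /lt_le_trans; exact.
Qed.

(** All weights and all divergences to the ends of the box are positive, and there are finitely many
    of them. This supplies the accuracy on an alternative that [limsup_difficulty_ge] asks for. *)
Lemma static_error_rate (A : alg_family R K) w mu :
  positive_simplex w -> static_proportions istar w A ->
  positivity_problems F theta mu ->
  exists C c, 0 < c /\
    forall T, (0 < T)%N -> error F istar (A T) mu <= C * expR (- (T%:R * c)).
Proof.
move=> [w0 _] stA pmu; have [l [u [Ml Mu lmuu box]]] := problem_box pmu.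
have Mmu := problem_mean pmu.
have klu k : 0 < kl (F k) (u k) (mu k).
  by apply: kl_gt0 => //; rewrite gt_eqF//; have /andP[] := lmuu k.
have kll k : 0 < kl (F k) (l k) (mu k).
  by apply: kl_gt0 => //; rewrite lt_eqF//; have /andP[] := lmuu k.
have [cu cu0 cuP] := @pos_lower_bound _ _ (fun k => w k * kl (F k) (u k) (mu k))
  (fun k => mulr_gt0 (w0 k) (klu k)).
have [cl cl0 clP] := @pos_lower_bound _ _ (fun k => w k * kl (F k) (l k) (mu k))
  (fun k => mulr_gt0 (w0 k) (kll k)).
have minl k : Num.min cl cu <= w k * kl (F k) (l k) (mu k) by rewrite ge_min clP.
have minu k : Num.min cl cu <= w k * kl (F k) (u k) (mu k) by rewrite ge_min cuP orbT.
have [C CP] := static_error_box stA Mmu Ml Mu lmuu box minl minu.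
by exists C, (Num.min cl cu); split => //; rewrite lt_min cl0.
Qed.

(** Whatever arms are chosen, [T] rounds on [lam] collect at most T d of information against [mu];
    accuracy on [lam] then prevents the error on [mu] from decaying at a rate above [d]. *)
Lemma limsup_difficulty_ge (A : alg_family R K) lam mu (C c d : R) :
  mean_vectors F lam -> mean_vectors F mu -> istar lam <> istar mu ->
  0 < c ->
  (forall T, (0 < T)%N -> error F istar (A T) lam <= C * expR (- (T%:R * c))) ->
  0 < d -> (forall k, kl (F k) (lam k) (mu k) <= d) ->
  (d^-1%:E <= limn_esup (fun T => difficulty F istar (A T) mu))%E.
Proof.
move=> Mlam Mmu neq c0 errl d0 kld; apply/lee_subgt0Pr => e e0.
rewrite -EFinB; set r := d^-1 - e.
have [r0|r0] := leP r 0.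
  apply: (@le_trans _ _ 0%E); first by rewrite lee_fin.
  apply: limn_esup_ge => N; exists N => //; exact: difficulty_ge0.
have dr : d < r^-1 by rewrite invf_pgt ?posrE// /r ltrBlDr ltrDl.
(* The margin [g] between the two rates is split: T g / 2 pays for the additive 1 of the
   transportation bound and T g / 2 for the error on [lam]. *)
set g := r^-1 - d; have g0 : 0 < g by rewrite subr_gt0.
have rg0 : 0 < r * g / 2 by rewrite divr_gt0// mulr_gt0.
have [N1 N1P] := exp_rate_small C c0 rg0.
have [N2 N2P] := nat_above (2 / g).
apply: limn_esup_ge => N; set T := (N + N1 + N2).+1.
have [NT NT1 NT2 _] := ltn_add3 (ltnSn (N + N1 + N2)); exists T => //.
apply: difficulty_ge => //; rewrite leNgt; apply/negP => small.
have := error_lt_transportation Mlam Mmu neq r0 small.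
apply/negP; rewrite -leNgt.
have marm : measurable_arm T (alg_arm (A T)) by exact: alg_arm_measurable.
have hD : expectation (fun k => ef_dist (F k) (lam k)) (alg_arm (A T))
    (path_sum (alg_arm (A T)) (fun k _ => kl (F k) (lam k) (mu k))) T [::] <= T%:R * d.
  rewrite -[leRHS](expectation_cst (fun k => ef_dist (F k) (lam k)) (alg_arm (A T)) _ T [::]).
  apply: (expectation_le _ marm) => //.
  - exact: bounded_measurable_path_sum.
  - exact: bounded_measurable_cst.
  move=> s sT; rewrite /path_sum sT big_mkord.
  by apply: le_trans (ler_sum _ (fun i _ => kld _)) _; rewrite sumr_const card_ord mulr_natl.
have T0 : 0 < T%:R :> R by rewrite ltr0n.
have hT : 1 <= T%:R * (g / 2).
  have := N2P T NT2; rewrite ler_pdivrMr// => h; lra.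
have he : T%:R / r * error F istar (A T) lam <= T%:R * (g / 2).
  have := le_trans (errl T isT) (N1P T NT1) => h.
  have -> : T%:R * (g / 2) = T%:R / r * (r * g / 2) by field; rewrite gt_eqF.
  by rewrite ler_wpM2l// divr_ge0// ltW.
have gE : T%:R / r = T%:R * d + T%:R * g by rewrite /g -mulrDr addrC subrK.
rewrite mulrBr mulr1; clearbody g T; lra.
Qed.

End static.

(** * Static proportions *)

Section static_families.
Context {R : realType} {K : nat}.

(** Every T w_k is rounded down, and arm [k0] gets the remainder, which is a sum of [K] fractional
    parts. *)
Lemma exists_counts (w : 'I_K -> R) T : (0 < K)%N -> positive_simplex w ->
  exists n : 'I_K -> nat, (\sum_k n k = T)%N /\
    forall k, `|(n k)%:R - T%:R * w k| <= K%:R.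
Proof.
move=> K0 [w0 w1]; pose k0 := Ordinal K0.
pose m k := Num.truncn (T%:R * w k).
have Tw k : 0 <= T%:R * w k by rewrite mulr_ge0// ltW.
have mle k : (m k)%:R <= T%:R * w k by rewrite truncn_le.
have mgt k : T%:R * w k < (m k)%:R + 1 by rewrite natr1 truncnS_gt.
have sumTw : \sum_k T%:R * w k = T%:R by rewrite -mulr_sumr w1 mulr1.
have sumT : (\sum_k m k <= T)%N.
  by rewrite -(ler_nat R) natr_sum -[leRHS]sumTw; apply: ler_sum.
pose rest := (T - \sum_k m k)%N.
have restE : rest%:R = \sum_k (T%:R * w k - (m k)%:R).
  by rewrite /rest natrB// sumrB sumTw natr_sum.
have rest0 : 0 <= rest%:R :> R by [].
have restK : rest%:R <= K%:R :> R.
  have -> : K%:R = \sum_(k < K) 1 :> R by rewrite sumr_const card_ord.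
  rewrite restE; apply: ler_sum => k _.
  by have := mgt k; lra.
have h k : `|(m k)%:R - T%:R * w k| <= 1.
  by rewrite ler_norml; have := mgt k; have := mle k; lra.
exists (fun k => m k + (k == k0) * rest)%N; split.
  rewrite big_split/= -big_distrl/=.
  have -> : (\sum_k (k == k0) = 1)%N.
    by rewrite (bigD1 k0)//= big1 ?addn0 ?eqxx// => k /negbTE kk0; rewrite kk0.
  by rewrite mul1n subnKC.
move=> k; have [->|kk0] := eqVneq k k0; rewrite ?mul1n ?mul0n ?addn0; last first.
  by rewrite (le_trans (h k))// ler1n.
rewrite natrD ler_norml; have := mle k0; have := mgt k0.
have : 1 <= K%:R :> R by rewrite ler1n.
(* The excess of arm [k0] is the sum of the fractional parts of the other arms. *)
have : (m k0)%:R - T%:R * w k0 + rest%:R = \sum_(k | k != k0) (T%:R * w k - (m k)%:R).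
  by rewrite restE (bigD1 k0)//=; lra.
have : 0 <= \sum_(k | k != k0) (T%:R * w k - (m k)%:R).
  by apply: sumr_ge0 => i _; have := mle i; lra.
lra.
Qed.

Lemma exists_schedule (n : 'I_K -> nat) :
  exists sch : seq 'I_K, size sch = (\sum_k n k)%N /\
    forall k, count_mem k sch = n k.
Proof.
exists (flatten [seq nseq (n k) k | k <- enum 'I_K]); split.
  rewrite size_flatten /shape -map_comp sumnE big_map big_enum/=.
  by apply: eq_bigr => k _; rewrite /= size_nseq.
move=> k; rewrite count_flatten -map_comp sumnE big_map big_enum/=.
rewrite (bigD1 k)//= big1 ?addn0 => [|i ik]; rewrite count_nseq/= ?eqxx ?mul1n//.
by rewrite (negbTE ik).
Qed.

(** The arm is read off the schedule at the length of the history, so the counts do not depend on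
    the samples. *)
Lemma exists_static_algorithm T (sch : seq 'I_K) (ans : ('I_K -> R) -> answer) :
  (0 < K)%N -> size sch = T ->
  (forall a, measurable [set v : K.-tuple (measurableTypeR R) | ans (tnth v) = a]) ->
  exists A : algorithm R K T,
    (forall (s : T.-tuple R) k, num_samples A s k = count_mem k sch) /\
    (forall s : T.-tuple R, alg_answer A s = ans (empirical_mean A s)).
Proof.
move=> K0 schT mans; pose k0 := Ordinal K0.
pose arm (s : seq R) := nth k0 sch (size s).
have marm t : (t < T)%N -> forall k,
    measurable [set s : t.-tuple (measurableTypeR R) | arm s = k].
  move=> tT k; rewrite (_ : [set _ | _] =
      if nth k0 sch t == k then setT else set0); first by case: ifP.
  apply/seteqP; split => s /=; rewrite /arm size_tuple; first by move=> ->; rewrite eqxx.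
  by case: eqP.
have mcst a : measurable [set s : T.-tuple (measurableTypeR R) | AllAbove = a].
  case: a; first by rewrite (_ : [set _ | _] = setT)//; apply/seteqP.
  by rewrite (_ : [set _ | _] = set0)//; apply/seteqP; split.
(* [empirical_mean] takes an algorithm but uses only its sampling rule; this one, with a dummy
   answer, lets the actual answer be written down. *)
pose A0 : algorithm R K T := @Algorithm R K T arm (fun=> AllAbove) marm mcst.
have armE (s : T.-tuple R) (t : 'I_T) : arm (take t s) = nth k0 sch t.
  by rewrite /arm size_take size_tuple ltn_ord.
have memp k : measurable_fun setT (fun s : T.-tuple (measurableTypeR R) =>
    empirical_mean A0 s k).
  have : measurable_fun setT (fun s : T.-tuple (measurableTypeR R) =>
      (\sum_(t < T) if nth k0 sch t == k then tnth s t else 0) *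
      (\sum_(t < T) (nth k0 sch t == k))%N%:R^-1).
    apply: measurable_funM => //; apply: measurable_sum => t.
    by case: (nth k0 sch t == k) => //; exact: measurable_tnth.
  apply: eq_measurable_fun => s _.
  rewrite /empirical_mean /num_samples -big_mkcond/=.
  congr (_ * _^-1).
    rewrite /A0/=; apply: eq_big => t; first by rewrite armE.
    by move=> _; rewrite (tnth_nth 0).
  by congr (_%:R); apply: eq_bigr => t _; rewrite /A0/= armE.
have mA a : measurable [set s : T.-tuple (measurableTypeR R) |
    ans (empirical_mean A0 s) = a].
  pose g (s : T.-tuple (measurableTypeR R)) : K.-tuple (measurableTypeR R) :=
    [tuple empirical_mean A0 s k | k < K].
  have mg : measurable_fun setT g.
    apply/measurable_fun_tnthP => k; apply: eq_measurable_fun (memp k) => s _.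
    by rewrite /= tnth_mktuple.
  have := mg measurableT _ (mans a); rewrite setTI.
  congr measurable; apply/seteqP; split => s /=;
    by rewrite (_ : tnth (g s) = empirical_mean A0 s)//; apply/funext => k; rewrite tnth_mktuple.
exists (@Algorithm R K T arm (fun s => ans (empirical_mean A0 s)) marm mA).
split=> // s k; rewrite /num_samples/=.
under eq_bigr do rewrite armE.
rewrite -sum1_count (big_nth k0) schT big_mkord [RHS]big_mkcond/=.
by apply: eq_bigr => t _; case: eqP.
Qed.

Lemma exists_static_family w (ans : ('I_K -> R) -> answer) :
  (0 < K)%N -> positive_simplex w ->
  (forall a, measurable [set v : K.-tuple (measurableTypeR R) | ans (tnth v) = a]) ->
  exists A : alg_family R K, static_proportions ans w A.
Proof.
move=> K0 sw mans.
have alg T : exists A : algorithm R K T, forall s : T.-tuple R,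
    (forall k, `|(num_samples A s k)%:R - T%:R * w k| <= K%:R) /\
    alg_answer A s = ans (empirical_mean A s).
  have [n [nT nw]] := exists_counts T K0 sw.
  have [sch [schT schn]] := exists_schedule n.
  have [A [AN Aans]] := exists_static_algorithm K0 (etrans schT nT) mans.
  by exists A => s; split => // k; rewrite AN schn.
pose A T : algorithm R K T := proj1_sig (cid (alg T)).
by exists A => T _ s; exact: (proj2_sig (cid (alg T))).
Qed.

End static_families.

(** * Uniform sampling *)

Section ereal_inverse.
Context {R : realType}.

Lemma ge_inve (H : \bar R) (q : R) : 0 < q -> (0 <= H)%E -> (H <= q^-1%:E)%E ->
  (q%:E <= H^-1)%E.
Proof.
move=> q0; case: H => [h| |]//; rewrite !lee_fin => h0 hq.
move: h0; rewrite le_eqVlt => /predU1P[<-|h0]; first by rewrite inve0 leey.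
by rewrite inver gt_eqF// lee_fin -[q]invrK lef_pV2// posrE invr_gt0.
Qed.

Lemma le_inve (H : \bar R) (q : R) : 0 < q -> (q^-1%:E <= H)%E ->
  (0 <= H^-1 <= q%:E)%E.
Proof.
move=> q0; case: H => [h| |]//; last by move=> _; rewrite invey lexx lee_fin ltW.
rewrite !lee_fin => hq; have h0 : 0 < h by rewrite (lt_le_trans _ hq)// invr_gt0.
by rewrite inver gt_eqF// !lee_fin invr_ge0 ltW//= -[q]invrK lef_pV2// posrE invr_gt0.
Qed.

End ereal_inverse.

Section upper_bound.
Context {R : realType} {K : nat}.
Variables (F : 'I_K -> exp_family R) (theta : R) (istar : ('I_K -> R) -> answer).
Hypotheses (K0 : (0 < K)%N) (htheta : forall k, ef_means (F k) theta)
  (histar : correct_answer F theta istar).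
Local Notation H := (oracle_difficulty F istar (static_families istar)).

(** Crossing [theta] costs arbitrarily little more than reaching it, by [kl_lt_near];
    [ex_mean_below] is the same on the other side. *)
Lemma ex_mean_above E (y e : R) : ef_means E theta -> ef_means E y -> 0 < e ->
  exists x, [/\ ef_means E x, theta < x & kl E x y <= kl E theta y + e].
Proof.
move=> Mt My e0; have [d d0 dP] := kl_lt_near Mt My e0.
have /(_ _ Mt)/nbhs_ballP[r/= r0 rM] := @ef_means_open _ E.
have m0 : 0 < Num.min r d by rewrite lt_min r0.
have md : Num.min r d <= d by rewrite ge_min lexx orbT.
have mr : Num.min r d <= r by rewrite ge_min lexx.
exists (theta + Num.min r d / 2).
have Mx : ef_means E (theta + Num.min r d / 2).
  by apply: rM; rewrite /ball/= opprD addrA subrr sub0r normrN gtr0_norm; lra.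
split => //; first by lra.
by apply/ltW/dP => //; rewrite addrC addKr gtr0_norm; lra.
Qed.

Lemma ex_mean_below E (y e : R) : ef_means E theta -> ef_means E y -> 0 < e ->
  exists x, [/\ ef_means E x, x < theta & kl E x y <= kl E theta y + e].
Proof.
move=> Mt My e0; have [d d0 dP] := kl_lt_near Mt My e0.
have /(_ _ Mt)/nbhs_ballP[r/= r0 rM] := @ef_means_open _ E.
have m0 : 0 < Num.min r d by rewrite lt_min r0.
have md : Num.min r d <= d by rewrite ge_min lexx orbT.
have mr : Num.min r d <= r by rewrite ge_min lexx.
exists (theta - Num.min r d / 2).
have Mx : ef_means E (theta - Num.min r d / 2).
  by apply: rM; rewrite /ball/= opprB addrC subrK gtr0_norm; lra.
split => //; first by lra.
by apply/ltW/dP => //; rewrite addrC addKr normrN gtr0_norm; lra.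
Qed.

(** Every static family is exponentially accurate on every alternative, so the information bound
    applies to all of them, uniformly in the weights. *)
Lemma oracle_difficulty_ge mu (kappa : R) : mean_vectors F mu -> 0 < kappa ->
  (forall e, 0 < e -> exists lam, [/\ positivity_problems F theta lam,
    istar lam <> istar mu & forall k, kl (F k) (lam k) (mu k) <= kappa + e]) ->
  (kappa^-1%:E <= H mu)%E.
Proof.
move=> Mmu kappa0 alt; apply: le_ereal_inf_tmp => _ [A [w sw stA] <-].
apply/lee_subgt0Pr => e e0; rewrite -EFinB; set r := _ - _.
have [r0|r0] := leP r 0.
  apply: (@le_trans _ _ 0%E); first by rewrite lee_fin.
  by apply: limn_esup_ge => N; exists N => //; exact: difficulty_ge0.
(* This gap serves as the tolerance of the alternative, so that [kappa] plus it is exactly 1 / r. *)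
have rk : 0 < r^-1 - kappa.
  by rewrite subr_gt0 invf_pgt ?posrE// /r ltrBlDr ltrDl.
have [lam [plam neq kld]] := alt _ rk; rewrite addrC subrK in kld.
have [C [c [c0 errl]]] := static_error_rate htheta histar sw stA plam.
have := limsup_difficulty_ge (problem_mean plam) Mmu neq c0 errl _ kld.
by rewrite invr_gt0 invrK; exact.
Qed.

Lemma limit_ratio_le (A : alg_family R K) mu (kappa C : R) :
  0 < kappa -> (kappa^-1%:E <= H mu)%E ->
  (forall T, (0 < T)%N -> error F istar (A T) mu <= C * expR (- (T%:R * (K%:R^-1 * kappa)))) ->
  (limit_ratio F istar H A mu <= K%:R%:E)%E.
Proof.
move=> kappa0 Hge errA; apply/lee_addgt0Pr => e e0; rewrite -EFinD.
have K0' : 0 < K%:R :> R by rewrite ltr0n.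
(* Slightly above K / kappa, to absorb the constant [C]. *)
have r0 : 0 < (K%:R + e) / kappa by rewrite divr_gt0// addr_gt0.
have [|N NP] := difficulty_eventually_le r0 _ errA.
  rewrite invf_div mulrC ltr_pM2r// ltf_pV2 ?posrE ?addr_gt0//.
  by rewrite ltrDl.
apply: (@limn_esup_le _ _ _ N) => T /NP hT; rewrite /ratio.
have /andP[V0 Vk] := le_inve kappa0 Hge.
apply: (le_trans (lee_pmul (difficulty_ge0 _ _ _ _) V0 hT Vk)).
by rewrite -EFinM lee_fin divfK ?gt_eqF.
Qed.

(** Pushing one arm below [theta] already gives an alternative, so any [k] is allowed, in particular
    the cheapest. *)
Lemma all_above_difficulty_ge mu k : all_above F theta mu ->
  ((kl (F k) theta (mu k))^-1%:E <= H mu)%E.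
Proof.
move=> amu; have [Mmu mugt] := amu; have [iA iB _] := histar.
apply: oracle_difficulty_ge => //.
  by apply: kl_gt0 => //; rewrite lt_eqF.
move=> e e0; have [x [Mx xt klx]] := ex_mean_below (htheta k) (Mmu k) e0.
pose lam j := if j == k then x else mu j.
have Mlam : exists_below F theta lam.
  split; last by exists k; rewrite /lam eqxx.
  by move=> j; rewrite /lam; case: eqP => [->|].
exists lam; split; first by right.
  by rewrite iB// iA.
move=> j; rewrite /lam; have [->//|jk] := eqVneq j k.
by rewrite kl_self addr_ge0// ?kl_ge0// ltW.
Qed.

(** An alternative must lift every arm that is not above [theta]; the most expensive one bounds the
    information per round. *)
Lemma exists_below_difficulty_ge mu (kappa : R) : exists_below F theta mu -> 0 < kappa ->
  (forall k, mu k < theta -> kl (F k) theta (mu k) <= kappa) ->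
  (kappa^-1%:E <= H mu)%E.
Proof.
move=> bmu kappa0 klk; have [Mmu _] := bmu; have [iA iB _] := histar.
apply: oracle_difficulty_ge => // e e0.
have arm k : exists x, [/\ ef_means (F k) x, theta < x & kl (F k) x (mu k) <= kappa + e].
  have [x [Mx tx klx]] := ex_mean_above (htheta k) (Mmu k) e0.
  have [mut|tmu|mut] := ltgtP (mu k) theta.
  - exists x; split => //; apply: (le_trans klx); rewrite lerD2r; exact: klk.
  - by exists (mu k); split => //; rewrite kl_self addr_ge0// ltW.
  (* An arm exactly at [theta] has to be lifted too, at a cost of at most [e]. *)
  - exists x; split => //; apply: (le_trans klx); rewrite lerD2r mut kl_self.
    exact: ltW.
have [lam lamP] := boolp.choice arm.
have alam : all_above F theta lam by split => k; have [] := lamP k.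
exists lam; split; first by left.
  by rewrite iA// iB.
by move=> k; have [] := lamP k.
Qed.

(** Unlike [istar] it is prescribed everywhere, also at empirical means that no member has, so that
    only crossings of [theta] cause errors. *)
Definition threshold_answer (v : 'I_K -> R) : answer :=
  if `[< forall k, theta < v k >] then AllAbove else ExistsBelow.

Lemma measurable_threshold_answer a :
  measurable [set v : K.-tuple (measurableTypeR R) | threshold_answer (tnth v) = a].
Proof.
pose U : set (K.-tuple (measurableTypeR R)) := [set v | forall k, theta < tnth v k].
have mU : measurable U.
  rewrite (_ : U = \bigcap_(k in [set: 'I_K]) [set v | theta < tnth v k]).
    apply: fin_bigcap_measurable => // k _.
    have := @measurable_tnth _ (measurableTypeR R) K k measurableT `]theta, +oo[%classic.
    rewrite setTI => /(_ (measurable_itv _)); congr measurable.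
    by apply/seteqP; split => v /=; rewrite in_itv/= andbT.
  by apply/seteqP; split => [v Uv k _|v Uv k]; [exact: Uv|exact: Uv].
case: a.
  rewrite (_ : [set _ | _] = U)//; apply/seteqP; split => v /=; rewrite /threshold_answer.
    by case: asboolP.
  by move=> Uv; case: asboolP.
rewrite (_ : [set _ | _] = ~` U); first exact: measurableC.
apply/seteqP; split => v /=; rewrite /threshold_answer.
  by case: asboolP.
by move=> Uv; case: asboolP.
Qed.

Lemma ex_limit_ratio_le : exists A : alg_family R K,
  forall mu, positivity_problems F theta mu ->
  (limit_ratio F istar H A mu <= K%:R%:E)%E.
Proof.
have K0' : 0 < K%:R :> R by rewrite ltr0n.
pose w (k : 'I_K) : R := K%:R^-1.
have sw : positive_simplex w.
  split; first by move=> k; rewrite invr_gt0.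
  by rewrite sumr_const card_ord -[_ *+ _]mulr_natl divff// gt_eqF.
have [A stA] := exists_static_family K0 sw measurable_threshold_answer.
exists A => mu pmu; have Mmu := problem_mean pmu.
have [iA iB _] := histar.
have stN T (s : seq R) k : (0 < T)%N -> size s = T ->
    T%:R * w k - K%:R <= (num_samples (A T) s k)%:R /\
    alg_answer (A T) s = threshold_answer (empirical_mean (A T) s).
  move=> T0 sT; have [Nw ansA] := stA T T0 (Tuple (introT eqP sT)).
  by have := Nw k; rewrite ler_norml => /andP[+ _] => /=; split; [lra|].
case: (pmu) => [amu|bmu].
(* An error needs some arm to fall to [theta]: the union bound decays at the rate of the least
   divergence, which is also the one put into the lower bound on the oracle difficulty. *)
- have [Mm mut] := amu.
  have kl0 k : 0 < kl (F k) theta (mu k) by apply: kl_gt0 => //; rewrite lt_eqF.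
  have [k kmin] : exists k, forall j, kl (F k) theta (mu k) <= kl (F j) theta (mu j).
    exists [arg min_(k < Ordinal K0) kl (F k) theta (mu k)]%O.
    by case: arg_minP => // k _ kP j; exact: kP.
  apply: (limit_ratio_le (kl0 k) (all_above_difficulty_ge k amu)) => T T0.
  apply: (@deviation_rate _ _ F _ (A T) mu _ _ id (fun=> theta) w) => //.
  + exact: bounded_measurable_answer.
  + by move=> i; rewrite ler_wpM2l// invr_ge0 ltW.
  move=> s sT /=; have [_ ->] := stN T s k T0 sT.
  rewrite iA// /threshold_answer; case: asboolP => // /existsNP[j /negP].
  rewrite -leNgt => ej _; exists j; split; first by have [] := stN T s j T0 sT.
  by left.
(* An error needs all empirical means above [theta]; it is enough to follow the low arm of largest
   divergence, a single event indexed by [unit]. *)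
- have [Mm [k0 mut0]] := bmu.
  have kl0 k : mu k < theta -> 0 < kl (F k) theta (mu k).
    by move=> mkt; apply: kl_gt0 => //; rewrite gt_eqF.
  have [k [mut kmax]] : exists k, mu k < theta /\
      forall j, mu j < theta -> kl (F j) theta (mu j) <= kl (F k) theta (mu k).
    exists [arg max_(k > k0 | mu k < theta) kl (F k) theta (mu k)]%O.
    by case: arg_maxP => // k mkt kP; split => // j; exact: kP.
  apply: (limit_ratio_le (kl0 k mut) (exists_below_difficulty_ge bmu (kl0 k mut) kmax)) => T T0.
  apply: (@deviation_rate _ _ F _ (A T) mu _ unit (fun=> k) (fun=> theta) (fun=> K%:R^-1)) => //.
  + exact: bounded_measurable_answer.
  move=> s sT /=; have [Nk ->] := stN T s k T0 sT.
  rewrite iB// /threshold_answer; case: asboolP => // emp _; exists tt; split => //.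
  by right; split => //; exact/ltW/emp.
Qed.

End upper_bound.

(** * Lower bound *)

Section lower_bound.
Context {R : realType} {K : nat}.
Variables (F : 'I_K -> exp_family R) (theta : R) (istar : ('I_K -> R) -> answer).
Hypotheses (K0 : (0 < K)%N) (htheta : forall k, ef_means (F k) theta)
  (histar : correct_answer F theta istar).
Local Notation H := (oracle_difficulty F istar (static_families istar)).

Lemma oracle_difficulty_ge0 mu : (0 <= H mu)%E.
Proof.
apply: le_ereal_inf_tmp => _ [A _ <-].
by apply: limn_esup_ge => N; exists N => //; exact: difficulty_ge0.
Qed.

Lemma oracle_difficulty_le mu w (A : alg_family R K) (C c : R) :
  positive_simplex w -> static_proportions istar w A -> 0 < c ->
  (forall T, (0 < T)%N -> error F istar (A T) mu <= C * expR (- (T%:R * c))) ->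
  (H mu <= c^-1%:E)%E.
Proof.
move=> sw stA c0 errA; apply: ge_ereal_inf.
exists (limn_esup (fun T => difficulty F istar (A T) mu)).
  by exists A => //; exists w.
exact: limsup_difficulty_le errA.
Qed.

(** The margin [c] is uniform over the inner interval, hence available before the pair of means of
    [arm_pair] is chosen inside it. *)
Lemma arm_margin E : ef_means E theta -> exists l a b u c,
  [/\ [/\ ef_means E l, ef_means E a, ef_means E b & ef_means E u],
      [/\ l < a, a < theta, theta < b & b < u], 0 < c &
      forall y, a < y < b -> c <= kl E u y /\ c <= kl E l y].
Proof.
move=> Mt; have /(_ _ Mt)/nbhs_ballP[r/= r0 rM] := @ef_means_open _ E.
have Mr t : `|theta - t| < r -> ef_means E t by exact: rM.
have Ml : ef_means E (theta - r / 2).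
  by apply: Mr; rewrite opprB addrC subrK gtr0_norm; lra.
have Ma : ef_means E (theta - r / 3).
  by apply: Mr; rewrite opprB addrC subrK gtr0_norm; lra.
have Mb : ef_means E (theta + r / 3).
  by apply: Mr; rewrite opprD addrA subrr sub0r normrN gtr0_norm; lra.
have Mu : ef_means E (theta + r / 2).
  by apply: Mr; rewrite opprD addrA subrr sub0r normrN gtr0_norm; lra.
exists (theta - r / 2), (theta - r / 3), (theta + r / 3), (theta + r / 2).
set c1 := kl E (theta + r / 2) (theta + r / 3).
set c2 := kl E (theta - r / 2) (theta - r / 3).
have c10 : 0 < c1 by apply: kl_gt0 => //; rewrite gt_eqF//; lra.
have c20 : 0 < c2 by apply: kl_gt0 => //; rewrite lt_eqF//; lra.
exists (Num.min c1 c2); split => //; first by split; lra.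
  by rewrite lt_min c10.
move=> y /andP[ay yb]; have My : ef_means E y.
  by apply: (means_between Ma Mb); rewrite !ltW.
split; rewrite ge_min.
  by rewrite kl_ltr//; lra.
by apply/orP; right; apply: kl_rtl => //; lra.
Qed.

(** First [nu] is taken so close to [theta] that its divergence is below [e * c]; only then [m], at
    a distance depending on [nu], so that starting from [m] instead of [theta] costs a factor 1 +
    e. *)
Lemma arm_pair E (a b c e : R) : ef_means E theta -> ef_means E a -> ef_means E b ->
  a < theta < b -> 0 < c -> 0 < e -> exists nu m,
  [/\ ef_means E nu /\ ef_means E m, a < nu < theta, theta < m < b,
      0 < kl E theta nu <= e * c & kl E m nu <= (1 + e) * kl E theta nu].
Proof.
move=> Mt Ma Mb /andP[at_ tb] c0 e0.
have [d d0 dP] := kl_small Mt (mulr_gt0 e0 c0).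
set r := Num.min d (theta - a); have r0 : 0 < r by rewrite lt_min d0 subr_gt0.
have rd : r <= d by rewrite ge_min lexx.
have ra : r <= theta - a by rewrite ge_min lexx orbT.
pose nu := theta - r / 2.
have anu : a < nu < theta by rewrite /nu; lra.
have Mnu : ef_means E nu by apply: (means_between Ma Mt); have /andP[/ltW-> /ltW->] := anu.
have x0 : 0 < kl E theta nu by apply: kl_gt0 => //; rewrite gt_eqF//; have /andP[] := anu.
have [d' d'0 d'P] := kl_lt_near Mt Mnu (mulr_gt0 e0 x0).
set r' := Num.min d' (b - theta); have r'0 : 0 < r' by rewrite lt_min d'0 subr_gt0.
have rd' : r' <= d' by rewrite ge_min lexx.
have rb : r' <= b - theta by rewrite ge_min lexx orbT.
pose m := theta + r' / 2.
have tm : theta < m < b by rewrite /m; lra.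
have Mm : ef_means E m by apply: (means_between Mt Mb); have /andP[/ltW-> /ltW->] := tm.
exists nu, m; split => //.
  by rewrite x0/= ltW// dP// /nu; lra.
have := d'P m Mm; rewrite /m addrC addKr gtr0_norm; last by lra.
by move=> h; rewrite mulrDl mul1r ltW// h; lra.
Qed.

(** The expected counts of the [K] arms add up to [T], so they cannot all exceed T / K. *)
Lemma least_sampled_arm (nu : 'I_K -> probability (measurableTypeR R) R) arm T :
  measurable_arm T arm ->
  exists j : 'I_K, K%:R * expectation nu arm
    (path_sum arm (fun k (_ : R) => (k == j)%:R)) T [::] <= T%:R.
Proof.
move=> marm; apply: contrapT => /forallNP many.
pose N (j : 'I_K) := expectation nu arm (path_sum arm (fun k (_ : R) => (k == j)%:R)) T [::].
have sumN : \sum_j N j = T%:R.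
  rewrite /N -expectation_sum//; last by move=> j; exact: bounded_measurable_path_sum.
  transitivity (expectation nu arm (fun s => path_sum arm (fun _ _ => 1) s) T [::]).
    congr (expectation _ _ _ _ _); apply/funext => s.
    rewrite /path_sum exchange_big/=; apply: eq_bigr => t _.
    rewrite (bigD1 (arm (take t s)))//= eqxx big1 ?addr0// => k /negbTE.
    by rewrite eq_sym => ->.
  have bm1 := bounded_measurable_path_sum (fun=> 1 : R) marm.
  have bmT := bounded_measurable_cst T (T%:R : R).
  have E s : size s = T -> path_sum arm (fun _ _ => 1) s = T%:R :> R.
    by move=> sT; rewrite /path_sum sT big_mkord sumr_const card_ord.
  apply/eqP; rewrite eq_le -[leRHS](expectation_cst nu arm T%:R T [::]).
  rewrite -[X in _ && (X <= _)](expectation_cst nu arm T%:R T [::]).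
  by apply/andP; split; apply: (expectation_le _ marm) => // s /E ->.
have : \sum_(j < K) T%:R < \sum_(j < K) K%:R * N j :> R.
  apply: ltr_sum.
    by apply/hasP; exists (Ordinal K0) => //; rewrite mem_index_enum.
  by move=> j _; rewrite ltNge; apply/negP; exact: many.
by rewrite -mulr_sumr sumN sumr_const card_ord -[X in X < _]mulr_natl ltxx.
Qed.

(* The proportions put almost all the mass on arm j, so that the event that
   the empirical mean of another arm leaves (l k, u k), where istar is
   arbitrary, is not the dominant one. *)
Lemma oracle_difficulty_one_below lam (l u : 'I_K -> R) (e c : R) j :
  0 < e -> K%:R * e < 1 -> mean_vectors F lam -> mean_vectors F l -> mean_vectors F u ->
  lam j < theta -> (forall k, k != j -> lam k < u k) -> (forall k, l k < lam k) ->
  (forall k, k != j -> c <= kl (F k) (u k) (lam k)) ->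
  (forall k, c <= kl (F k) (l k) (lam k)) ->
  kl (F j) theta (lam j) <= e * c ->
  (H lam <= ((1 - K%:R * e) * kl (F j) theta (lam j))^-1%:E)%E.
Proof.
move=> e0 Ke Mlam Ml Mu ljt lu ll cu cl xe.
have [iA iB _] := histar.
have K1 : 1 <= K%:R :> R by rewrite ler1n.
(* Weight [e] on every other arm leaves at least 1 - K e for arm [j]. *)
pose w k : R := if k == j then 1 - (K%:R - 1) * e else e.
have wj : 1 - K%:R * e <= w j by rewrite /w eqxx; lra.
have wk k : k != j -> w k = e by rewrite /w => /negbTE ->.
have sw : positive_simplex w.
  split; first by move=> k; rewrite /w; case: eqP => // _; nra.
  rewrite (bigD1 j)//= (eq_bigr (fun=> e)) => [|k kj]; last exact: wk.
  rewrite sumr_const cardC1 card_ord -mulr_natl /w eqxx -subn1 natrB//.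
  by rewrite subrK.
have [_ _ mi] := histar.
have [A stA] := exists_static_family K0 sw mi.
(* Arm [j] may rise up to [theta]; the other arms may cross it freely, as one low arm fixes the
   answer. *)
pose u' k := if k == j then theta else u k.
have Mu' : mean_vectors F u' by move=> k; rewrite /u'; case: eqP => [->|].
have x0 : 0 < kl (F j) theta (lam j) by apply: kl_gt0 => //; rewrite gt_eqF.
set x := kl (F j) theta (lam j) in xe x0 *.
have c0 : 0 < c by have := lt_le_trans x0 xe; rewrite pmulr_rgt0.
have e1 : e < 1 by nra.
have q0 : 0 < 1 - K%:R * e by lra.
have xc : x <= c by apply: (le_trans xe); nra.
have q1 : 1 - K%:R * e <= 1 by rewrite gerBl mulr_ge0// ltW.
(* The target rate is at most [e * c], which the other arms reach despite their small weight. *)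
have qx : (1 - K%:R * e) * x <= e * c.
  by apply: le_trans xe; rewrite ler_piMl// ltW.
have rate k y : k != j -> c <= y -> (1 - K%:R * e) * x <= w k * y.
  by move=> kj cy; rewrite wk//; apply: (le_trans qx); rewrite ler_wpM2l// ltW.
have box v : (forall k, l k < v k < u' k) -> istar v = istar lam.
  move=> vbox; rewrite [RHS]iB; last by split => //; exists j.
  apply: iB; split; last first.
    by exists j; have /andP[_] := vbox j; rewrite /u' eqxx.
  by move=> k; apply: (means_between (Ml k) (Mu' k)); have /andP[/ltW-> /ltW->] := vbox k.
have lamu k : l k < lam k < u' k.
  by rewrite ll/= /u'; have [->//|kj] := eqVneq k j; exact: lu.
have [|k|C CP] := static_error_box (c := (1 - K%:R * e) * x) stA Mlam Ml Mu' lamu box.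
- move=> k; have [->|kj] := eqVneq k j; last by apply: rate => //; exact: cl.
  by apply: ler_pM => //; [exact: ltW|exact: ltW|exact: (le_trans xc (cl j))].
- rewrite /u'; have [->|kj] := eqVneq k j; last by apply: rate => //; exact: cu.
  by rewrite ler_wpM2r// ltW.
exact: (oracle_difficulty_le sw stA (mulr_gt0 q0 x0) CP).
Qed.

Lemma le_sup_limit_ratio (A : alg_family R K) mu (r q : R) :
  positivity_problems F theta mu -> 0 < r -> 0 < q -> (H mu <= q^-1%:E)%E ->
  (forall N, exists T, [/\ (N <= T)%N, (0 < T)%N &
     expR (- (T%:R / r)) <= error F istar (A T) mu]) ->
  ((r * q)%:E <= ereal_sup [set limit_ratio F istar H A lam
       | lam in positivity_problems F theta])%E.
Proof.
move=> pmu r0 q0 Hq often; apply: (@le_trans _ _ (limit_ratio F istar H A mu)); last first.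
  by apply: ereal_sup_ubound; exists mu.
apply: limn_esup_ge => N; have [T [NT T0 errT]] := often N.
exists T => //; rewrite /ratio EFinM; apply: lee_pmul.
- by rewrite lee_fin ltW.
- by rewrite lee_fin ltW.
- exact: difficulty_ge.
- by apply: ge_inve => //; exact: oracle_difficulty_ge0.
Qed.

(** Each factor records one loss: 1 - e the error on [mu], 1 + e the passage from [theta] to [mu j],
    the further [e] the additive 1 of transportation, and 1 - K e the weights of the static
    family. *)
Lemma sup_limit_ratio_ge (A : alg_family R K) (e : R) : 0 < e -> K%:R * e < 1 ->
  (((1 - e) * K%:R / (1 + e + e) * (1 - K%:R * e))%:E <=
   ereal_sup [set limit_ratio F istar H A lam | lam in positivity_problems F theta])%E.
Proof.
move=> e0 Ke; have K1 : 1 <= K%:R :> R by rewrite ler1n.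
have e1 : e < 1 by nra.
have [iA iB _] := histar.
have [l lP] := boolp.choice (fun k => arm_margin (htheta k)).
have [a aP] := boolp.choice lP; have [b bP] := boolp.choice aP.
have [u uP] := boolp.choice bP; have [c' c'P] := boolp.choice uP.
(* One margin for all arms, so that the condition [e * c] on one arm can be compared with the
   divergences of the others. *)
have [c c0 cc'] := @pos_lower_bound R _ c' (fun k => let: And4 _ _ h _ := c'P k in h).
have pair k : exists nm : R * R, [/\ ef_means (F k) nm.1 /\ ef_means (F k) nm.2,
    a k < nm.1 < theta, theta < nm.2 < b k, 0 < kl (F k) theta nm.1 <= e * c &
    kl (F k) nm.2 nm.1 <= (1 + e) * kl (F k) theta nm.1].
  have [[_ Ma Mb _] [_ aT bT _] _ _] := c'P k.
  have [|nu [m h]] := arm_pair (htheta k) Ma Mb _ c0 e0; first by rewrite aT.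
  by exists (nu, m).
have [nm nmP] := boolp.choice pair.
pose nu k := (nm k).1; pose mu k := (nm k).2.
have amu : all_above F theta mu.
  by split => k; have [[_ Mm] _ /andP[tm _] _ _] := nmP k.
have Mmu : mean_vectors F mu by case: amu.
pose lam j k := if k == j then nu k else mu k.
have Mlam j : mean_vectors F (lam j).
  by move=> k; rewrite /lam; case: ifP => _; have [[]] := nmP k.
have blam j : exists_below F theta (lam j).
  split => //; exists j; rewrite /lam eqxx.
  by have [_ /andP[]] := nmP j.
have ab k j : a k < lam j k < b k.
  have [_ _ _ _] := nmP k => _; have [_ /andP[h1 h2] /andP[h3 h4] _ _] := nmP k.
  rewrite /lam /nu /mu; case: ifP => _; first by rewrite h1 (lt_trans h2)// (lt_trans h3).
  by rewrite h4 andbT (lt_trans h1)// (lt_trans h2).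
pose x j := kl (F j) theta (nu j).
have x0 j : 0 < x j by have [_ _ _ /andP[]] := nmP j.
have Hlam j : (H (lam j) <= ((1 - K%:R * e) * x j)^-1%:E)%E.
  have -> : x j = kl (F j) theta (lam j j) by rewrite /lam eqxx.
  apply: (@oracle_difficulty_one_below (lam j) l u e c) => //.
  - by move=> k; have [[]] := c'P k.
  - by move=> k; have [[]] := c'P k.
  - by rewrite /lam eqxx; have [_ /andP[]] := nmP j.
  - move=> k kj; have /andP[_ lb] := ab k j; have [_ [_ _ _ bu] _ _] := c'P k.
    exact: lt_trans bu.
  - move=> k; have /andP[al _] := ab k j; have [_ [la _ _ _] _ _] := c'P k.
    exact: lt_trans al.
  - move=> k _; apply: (le_trans (cc' k)).
    by have [_ _ _ /(_ _ (ab k j))[]] := c'P k.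
  - move=> k; apply: (le_trans (cc' k)).
    by have [_ _ _ /(_ _ (ab k j))[]] := c'P k.
  - by rewrite /lam eqxx; have [_ _ _ /andP[]] := nmP j.
have target_le : (1 - e) * K%:R / (1 + e + e) * (1 - K%:R * e) <= K%:R.
  have h : 0 < 1 + e + e by lra.
  rewrite mulrAC ler_pdivrMr//.
  have h1 : (1 - e) * (1 - K%:R * e) <= 1 by apply: mulr_ile1; nra.
  by nra.
(* If the error on [mu] recurrently stays above [e], any difficulty is exceeded there; r = K / q is
   enough. Otherwise the algorithm is eventually accurate on [mu]. *)
have [oft|] := pselect (forall N, exists T, (N <= T)%N /\ e <= error F istar (A T) mu).
  have [w sw] : exists w : 'I_K -> R, positive_simplex w.
    exists (fun=> K%:R^-1); split; first by move=> k; rewrite invr_gt0; lra.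
    by rewrite sumr_const card_ord -[_ *+ _]mulr_natl divff// gt_eqF//; lra.
  have [_ _ mi] := histar; have [B stB] := exists_static_family K0 sw mi.
  have [C [q [q0 errB]]] := static_error_rate htheta histar sw stB (or_introl amu).
  have Hq := oracle_difficulty_le sw stB q0 errB.
  have r0 : 0 < K%:R / q by rewrite divr_gt0//; lra.
  apply: (@le_trans _ _ (K%:R / q * q)%:E).
    by rewrite lee_fin divfK// gt_eqF.
  apply: (le_sup_limit_ratio (or_introl amu) r0 q0 Hq) => N.
  have rV0 : 0 < (K%:R / q)^-1 by rewrite invr_gt0.
  have [N1 N1P] := exp_rate_small 1 rV0 e0.
  have [T [/ltn_add3[NT N1T _ T0] eT]] := oft (N + N1 + 0).+1.
  exists T; split => //; apply: le_trans eT.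
  by have := N1P T N1T; rewrite mul1r.
move=> /existsNP[N0 /forallNP small].
(* Pigeonhole over horizons: were each arm sampled too much from some horizon on, none would be a
   least sampled arm at the largest of these. *)
have [j jP] : exists j : 'I_K, forall N, exists T, (N <= T)%N /\
    K%:R * expectation (fun k => ef_dist (F k) (mu k)) (alg_arm (A T))
      (path_sum (alg_arm (A T)) (fun k (_ : R) => (k == j)%:R)) T [::] <= T%:R.
  apply: contrapT => /forallNP rare.
  have Mex i : exists N, forall T, (N <= T)%N ->
      ~ K%:R * expectation (fun k => ef_dist (F k) (mu k)) (alg_arm (A T))
      (path_sum (alg_arm (A T)) (fun k (_ : R) => (k == i)%:R)) T [::] <= T%:R.
    have /existsNP[N /forallNP hN] := rare i; exists N => T NT hT.
    by apply: (hN T).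
  have [M MP] := boolp.choice Mex.
  pose T := (\max_j M j)%N.
  have [j hj] := @least_sampled_arm (fun k => ef_dist (F k) (mu k)) (alg_arm (A T)) T
    (@alg_arm_measurable _ _ _ (A T)).
  by apply: (MP j T) hj; exact: leq_bigmax.
have q0 : 0 < 1 - K%:R * e by lra.
have xn0 : x j != 0 by rewrite gt_eqF.
(* Makes (1 - e) T / r equal to (1 + 2 e) x_j T / K, which exceeds the information available about
   arm [j] by e x_j T / K. *)
set r := (1 - e) * K%:R / ((1 + e + e) * x j).
have r0 : 0 < r.
  by rewrite /r divr_gt0// mulr_gt0//; lra.
have -> : (1 - e) * K%:R / (1 + e + e) * (1 - K%:R * e) = r * ((1 - K%:R * e) * x j).
  rewrite /r; field; apply/andP; split; [exact: xn0|by rewrite gt_eqF//; lra].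
apply: (le_sup_limit_ratio (or_intror (blam j)) r0 (mulr_gt0 q0 (x0 j)) (Hlam j)) => N.
(* From this horizon on, the excess e x_j T / K covers the additive 1. *)
have [N1 N1P] := nat_above (K%:R / (e * x j)).
have [T [/ltn_add3[NT N0T N1T T0'] NjT]] := jP (N + N0 + N1).+1.
exists T; split => //; rewrite leNgt; apply/negP => smallT.
have T0 : 0 < T%:R :> R by rewrite ltr0n.
have neq : istar mu <> istar (lam j) by rewrite iA// iB.
have := error_lt_transportation Mmu (Mlam j) neq r0 smallT.
have errmu : error F istar (A T) mu < e.
  by rewrite ltNge; apply/negP => h; exact: (small T).
have marm : measurable_arm T (alg_arm (A T)) by exact: alg_arm_measurable.
set nuT := fun k => _ in NjT *; set N' := expectation _ _ _ _ _ in NjT.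
have -> : expectation nuT (alg_arm (A T)) (path_sum (alg_arm (A T))
    (fun k _ => kl (F k) (mu k) (lam j k))) T [::] = kl (F j) (mu j) (nu j) * N'.
  have := expectation_lin nuT (kl (F j) (mu j) (nu j)) marm
    (bounded_measurable_path_sum (fun k => (k == j)%:R) marm)
    (bounded_measurable_cst T 0) (n := T) (s := [::]) erefl.
  rewrite expectation_cst addr0 => <-.
  congr (expectation _ _ _ _ _); apply/funext => s; rewrite addr0 /path_sum mulr_sumr.
  apply: eq_bigr => t _; rewrite /lam; set k := alg_arm _ _.
  by have [->|kj] := eqVneq k j; rewrite ?mulr1// kl_self mulr0.
have N'0 : 0 <= N'.
  rewrite /N' -[leLHS](expectation_cst nuT (alg_arm (A T)) 0 T [::]).
  apply: (expectation_le _ marm) => //; first exact: bounded_measurable_cst.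
    exact: bounded_measurable_path_sum.
  by move=> s _; rewrite /path_sum sumr_ge0.
apply/negP; rewrite -leNgt.
have [_ _ _ _ klj] := nmP j; rewrite -/(mu j) -/(nu j) -/(x j) in klj.
have h1 : kl (F j) (mu j) (nu j) * N' <= (1 + e) * x j * (T%:R / K%:R).
  apply: ler_pM => //; first by apply: kl_ge0; have [[]] := nmP j.
  by rewrite ler_pdivlMr; [rewrite mulrC|lra].
have h2 : T%:R / r * (1 - e) = (1 + e) * x j * (T%:R / K%:R) + e * x j * (T%:R / K%:R).
  by rewrite /r; field; apply/and4P; split; [|exact: xn0| |]; rewrite gt_eqF//; lra.
have h3 : T%:R / r * (1 - e) <= T%:R / r * (1 - error F istar (A T) mu).
  by apply: ler_wpM2l; [rewrite divr_ge0// ltW|lra].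
have h4 : 1 <= e * x j * (T%:R / K%:R).
  have := N1P T N1T; rewrite ler_pdivrMr ?mulr_gt0// => KT.
  rewrite mulrA ler_pdivlMr; last by lra.
  by rewrite mul1r mulrC.
by rewrite (le_trans _ h3)// h2 addrC lerD.
Qed.

End lower_bound.

Theorem theorem6 (R : realType) (K : nat) (hK : (0 < K)%N)
    (F : 'I_K -> exp_family R) (theta : R)
    (htheta : forall k, ef_means (F k) theta)
    (istar : ('I_K -> R) -> answer) (histar : correct_answer F theta istar) :
  ereal_inf
    [set ereal_sup
       [set limit_ratio F istar
              (oracle_difficulty F istar (static_families istar)) A lam
       | lam in positivity_problems F theta]
    | A in all_families] = K%:R%:E.
Proof.
apply/eqP; rewrite eq_le; apply/andP; split.
  have [A AP] := ex_limit_ratio_le hK htheta histar.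
  apply: ge_ereal_inf; eexists; first by exists A.
  by apply: ge_ereal_sup => _ [lam plam <-]; exact: AP.
apply: le_ereal_inf_tmp => _ [A _ <-].
apply/lee_subgt0Pr => d d0; rewrite -EFinB.
have K1 : 1 <= K%:R :> R by rewrite ler1n.
(* To first order in [e] the bound of [sup_limit_ratio_ge] loses K (K + 3) e: the numerator
   contributes K + 1 and the denominator 2. The minimum with 1 keeps [K%:R * e] below 1. *)
pose e := Num.min d 1 / (K%:R * (K%:R + 3)).
have m0 : 0 < Num.min d 1 by rewrite lt_min d0 ltr01.
have md : Num.min d 1 <= d by rewrite ge_min lexx.
have m1 : Num.min d 1 <= 1 by rewrite ge_min lexx orbT.
have KK : 0 < K%:R * (K%:R + 3) :> R by nra.
have e0 : 0 < e by rewrite divr_gt0.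
have eE : K%:R * (K%:R + 3) * e = Num.min d 1 by rewrite /e mulrC divfK// gt_eqF.
have Ke : K%:R * e < 1 by nra.
apply: le_trans (sup_limit_ratio_ge hK htheta histar A e0 Ke).
rewrite lee_fin mulrAC ler_pdivlMr; last lra.
have : K%:R - d <= K%:R - K%:R * (K%:R + 3) * e by lra.
have : 0 <= e * e by nra.
nra.
Qed.
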